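(* Let $(X,\phi)$ be a calibrated manifold. Suppose $f\in C^\infty(X)$ is a non-negative function which is strictly $\phi$-plurisubharmonic at each point in $A=\{x\in X:f(x)=0\}$. Given a point $x\in A$, there exist a neighborhood $U$ of $x$ and a proper $\phi$-free submanifold $M$ of $U$ such that $A\cap U\subset M$.
   Context: A calibrated manifold $(X,\phi)$ of degree $p\ge 1$ is a smooth riemannian manifold $X$ together with a closed smooth $p$-form $\phi$ such that $\phi(\xi)\le 1$ for every unit simple tangent $p$-vector $\xi$ on $X$. $G_x(\phi)$ denotes the set of unit simple $p$-vectors $\xi$ at $x$ with $\phi(\xi)=1$ ($\phi$-planes); each $\xi$ determines a $p$-dimensional subspace $\mathrm{span}\,\xi\subset T_xX$. For $f\in C^\infty(X)$, the $\phi$-Hessian of $f$ is the $p$-form $\mathcal H^\phi(f)(v_1,\dots,v_p)=\sum_{i=1}^p\phi(v_1,\dots,\nabla_{v_i}(\nabla f),\dots,v_p)$ ($\nabla_{v_i}(\nabla f)$ in the $i$-th slot, $\nabla$ the Levi-Civita connection). $f$ is strictly $\phi$-plurisubharmonic at $x$ if $\mathcal H^\phi(f)(\xi)>0$ for all $\xi\in G_x(\phi)$. A proper submanifold $M$ of $U$ is one that is (properly embedded, i.e.) a closed subset of $U$. It is $\phi$-free if there is no $y\in M$ and $\xi\in G_y(\phi)$ with $\mathrm{span}\,\xi\subset T_yM$. *)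

(* Defs.v *)
From mathcomp Require Import all_boot all_order all_algebra.
From mathcomp Require Import all_classical all_reals all_analysis.
Set Implicit Arguments.
Unset Strict Implicit.
Unset Printing Implicit Defensive.
Import Order.TTheory GRing.Theory Num.Theory.
Import numFieldNormedType.Exports.
Local Open Scope classical_set_scope.
Local Open Scope ring_scope.

(* C^k and C^oo on an open set [O] of R^n; values outside [O] are irrelevant. *)
Fixpoint Ck_on (R : realType) (n : nat) (V : normedModType R) (k : nat)
    (O : set 'rV[R]_n) (h : 'rV[R]_n -> V) : Prop :=
  match k with
  | 0%N => forall u, O u -> {for u, continuous h}
  | k'.+1 => (forall u, O u -> differentiable h u) /\
             (forall w : 'rV[R]_n, Ck_on k' O (fun u => 'D_w h u))
  end.

Definition smooth_on (R : realType) (n : nat) (V : normedModType R)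
    (O : set 'rV[R]_n) (h : 'rV[R]_n -> V) : Prop :=
  forall k, Ck_on k O h.

(* A chart is a homeomorphism from the open set [dom] onto the open set [cod];
   [chart_map] and [para] are total functions, arbitrary outside these sets. *)
Record chart (R : realType) (n : nat) (T : topologicalType) := Chart {
  dom : set T;
  cod : set 'rV[R]_n;
  chart_map : T -> 'rV[R]_n;
  para : 'rV[R]_n -> T;
  open_dom : open dom;
  open_cod : open cod;
  chart_map_cod : forall y, dom y -> cod (chart_map y);
  para_dom : forall u, cod u -> dom (para u);
  chart_mapK : forall y, dom y -> para (chart_map y) = y;
  paraK : forall u, cod u -> chart_map (para u) = u;
  continuous_chart_map : forall y, dom y -> {for y, continuous chart_map};
  continuous_para : forall u, cod u -> {for u, continuous para} }.

Definition transition (R : realType) (n : nat) (T : topologicalType)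
    (c d : chart R n T) : 'rV[R]_n -> 'rV[R]_n := chart_map d \o para c.

Definition overlap (R : realType) (n : nat) (T : topologicalType)
    (c d : chart R n T) : set 'rV[R]_n := cod c `&` para c @^-1` dom d.

Definition compatible (R : realType) (n : nat) (T : topologicalType)
    (c d : chart R n T) : Prop :=
  smooth_on (overlap c d) (transition c d) /\
  smooth_on (overlap d c) (transition d c).

(* Smooth n-manifolds: Hausdorff, second countable, with a maximal atlas. *)
Record smoothManifold (R : realType) (n : nat) := SmoothManifold {
  carrier :> topologicalType;
  carrier_hausdorff : hausdorff_space carrier;
  carrier_second_countable : @second_countable carrier;
  atlas : set (chart R n carrier);
  atlas_cover : forall y, exists2 c, atlas c & dom c y;
  atlas_compatible : forall c d, atlas c -> atlas d -> compatible c d;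
  atlas_maximal : forall c, (forall d, atlas d -> compatible c d) -> atlas c }.

Definition smooth_function (R : realType) (n : nat) (X : smoothManifold R n)
    (f : X -> R) : Prop :=
  forall c, atlas c -> smooth_on (cod c) (f \o para c).

(* Tensor fields are families of local expressions, one for each chart of the
   atlas, related by the usual transformation law.  A tangent vector is read in
   a chart as a row vector and a p-tuple of tangent vectors as the p x n matrix
   of its rows, so that changing the chart from c to d at the point of
   coordinates u is right multiplication by 'J (transition c d) u. *)

(* [g c u] is the matrix (g_ij) in the chart c at the point of coordinates u. *)
Record riemannianMetric (R : realType) (n : nat) (X : smoothManifold R n) :=
  RiemannianMetric {
  metric :> chart R n X -> 'rV[R]_n -> 'M[R]_n;
  metric_smooth : forall c, atlas c -> smooth_on (cod c) (metric c);
  metric_sym : forall c u, atlas c -> cod c u -> (metric c u)^T = metric c u;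
  metric_pos : forall c u (w : 'rV[R]_n), atlas c -> cod c u -> w != 0 ->
    0 < (w *m metric c u *m w^T) 0 0;
  metric_change : forall c d u, atlas c -> atlas d -> overlap c d u ->
    let J := 'J (transition c d) u in
    metric c u = J *m metric d (transition c d u) *m J^T }.

Definition set_row (R : realType) (p n : nat) (v : 'M[R]_(p, n)) (i : 'I_p)
    (w : 'rV[R]_n) : 'M[R]_(p, n) :=
  \matrix_(k, j) (if k == i then w 0 j else v k j).

(* [phi c u v] is the value on the rows of v, in the chart c at the point of
   coordinates u. *)
Record differentialForm (R : realType) (n : nat) (X : smoothManifold R n)
    (p : nat) := DifferentialForm {
  form :> chart R n X -> 'rV[R]_n -> 'M[R]_(p, n) -> R;
  form_smooth : forall c (v : 'M[R]_(p, n)), atlas c ->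
    smooth_on (cod c) (fun u => form c u v);
  form_linear : forall c u v (i : 'I_p) (a : R) (w1 w2 : 'rV[R]_n),
    atlas c -> cod c u ->
    form c u (set_row v i (a *: w1 + w2)) =
    a * form c u (set_row v i w1) + form c u (set_row v i w2);
  form_alternating : forall c u (v : 'M[R]_(p, n)) (i j : 'I_p),
    atlas c -> cod c u -> i != j -> row i v = row j v -> form c u v = 0;
  form_change : forall c d u (v : 'M[R]_(p, n)),
    atlas c -> atlas d -> overlap c d u ->
    form c u v = form d (transition c d u) (v *m 'J (transition c d) u) }.

(* Local expression of the exterior derivative: on constant vector fields all
   the Lie bracket terms of the invariant formula vanish. *)
Definition ext_deriv (R : realType) (n : nat) (X : smoothManifold R n)
    (p : nat) (phi : differentialForm X p) (c : chart R n X) (u : 'rV[R]_n)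
    (v : 'M[R]_(p.+1, n)) : R :=
  \sum_(i < p.+1) (-1) ^+ i * 'D_(row i v) (fun z => phi c z (row' i v)) u.

Definition closed_form (R : realType) (n : nat) (X : smoothManifold R n)
    (p : nat) (phi : differentialForm X p) : Prop :=
  forall c u v, atlas c -> cod c u -> ext_deriv phi c u v = 0.

(* The simple p-vector v_1 /\ ... /\ v_p has norm 1: its squared norm is the
   Gram determinant of the v_i. *)
Definition unit_simple (R : realType) (n : nat) (X : smoothManifold R n)
    (g : riemannianMetric X) (p : nat) (c : chart R n X) (y : X)
    (v : 'M[R]_(p, n)) : Prop :=
  \det (v *m g c (chart_map c y) *m v^T) = 1.

Definition calibrated (R : realType) (n : nat) (X : smoothManifold R n)
    (g : riemannianMetric X) (p : nat) (phi : differentialForm X p) : Prop :=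
  [/\ (1 <= p)%N,
      closed_form phi &
      forall (c : chart R n X) (y : X) (v : 'M[R]_(p, n)),
        atlas c -> dom c y -> unit_simple g c y v -> phi c (chart_map c y) v <= 1].

(* The rows of v represent, in the chart c, an element of G_y(phi). *)
Definition phi_plane (R : realType) (n : nat) (X : smoothManifold R n)
    (g : riemannianMetric X) (p : nat) (phi : differentialForm X p)
    (c : chart R n X) (y : X) (v : 'M[R]_(p, n)) : Prop :=
  unit_simple g c y v /\ phi c (chart_map c y) v = 1.

Definition gradient (R : realType) (n : nat) (X : smoothManifold R n)
    (g : riemannianMetric X) (f : X -> R) (c : chart R n X) (u : 'rV[R]_n) :
    'rV[R]_n :=
  (\row_j 'D_(delta_mx 0 j) (f \o para c) u) *m invmx (g c u).

(* Gamma^k_ij = 1/2 g^kl (d_i g_jl + d_j g_il - d_l g_ij) *)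
Definition christoffel (R : realType) (n : nat) (X : smoothManifold R n)
    (g : riemannianMetric X) (c : chart R n X) (u : 'rV[R]_n) (k i j : 'I_n) :
    R :=
  let dg (a b e : 'I_n) := 'D_(delta_mx 0 a) (fun z => g c z b e) u in
  2^-1 * \sum_(l < n) invmx (g c u) k l * (dg i j l + dg j i l - dg l i j).

(* Levi-Civita derivative, in the chart c at the point of coordinates u, of the
   vector field with local expression Y in the direction w. *)
Definition levi_civita (R : realType) (n : nat) (X : smoothManifold R n)
    (g : riemannianMetric X) (c : chart R n X) (w : 'rV[R]_n)
    (Y : 'rV[R]_n -> 'rV[R]_n) (u : 'rV[R]_n) : 'rV[R]_n :=
  'D_w Y u +
  \row_k \sum_(i < n) \sum_(j < n) christoffel g c u k i j * w 0 i * Y u 0 j.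

Definition phi_hessian (R : realType) (n : nat) (X : smoothManifold R n)
    (g : riemannianMetric X) (p : nat) (phi : differentialForm X p)
    (f : X -> R) (c : chart R n X) (y : X) (v : 'M[R]_(p, n)) : R :=
  let u := chart_map c y in
  \sum_(i < p)
    phi c u (set_row v i (levi_civita g c (row i v) (gradient g f c) u)).

Definition strictly_phi_psh (R : realType) (n : nat) (X : smoothManifold R n)
    (g : riemannianMetric X) (p : nat) (phi : differentialForm X p)
    (f : X -> R) (y : X) : Prop :=
  forall (c : chart R n X) (v : 'M[R]_(p, n)), atlas c -> dom c y ->
    phi_plane g phi c y v -> 0 < phi_hessian g phi f c y v.

(* The model slice R^k x 0 of R^n. *)
Definition slice (R : realType) (n k : nat) : set 'rV[R]_n :=
  [set w | forall i : 'I_n, (k <= i)%N -> w 0 i = 0].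

(* [d] flattens the k-dimensional [M]. *)
Definition slice_chart (R : realType) (n : nat) (X : smoothManifold R n)
    (k : nat) (M : set X) (d : chart R n X) : Prop :=
  atlas d /\ M `&` dom d = dom d `&` chart_map d @^-1` slice k.

(* Embedded k-dimensional submanifolds of the open set U, closed in U. *)
Definition proper_submanifold (R : realType) (n : nat) (X : smoothManifold R n)
    (k : nat) (U M : set X) : Prop :=
  [/\ (k <= n)%N,
      M `<=` U,
      exists2 C : set X, closed C & M = C `&` U &
      forall y, M y ->
        exists d, [/\ slice_chart k M d, dom d y & dom d `<=` U]].

(* T_y M, read in the chart c. *)
Definition tangent_space (R : realType) (n : nat) (X : smoothManifold R n)
    (k : nat) (M : set X) (c : chart R n X) (y : X) : set 'rV[R]_n :=
  [set w | exists d, [/\ slice_chart k M d, dom d y &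
                         slice k (w *m 'J (transition c d) (chart_map c y))]].

Definition phi_free (R : realType) (n : nat) (X : smoothManifold R n)
    (g : riemannianMetric X) (p : nat) (phi : differentialForm X p)
    (k : nat) (M : set X) : Prop :=
  ~ exists (y : X) (c : chart R n X) (v : 'M[R]_(p, n)),
      [/\ M y, atlas c, dom c y, phi_plane g phi c y v &
          [set w : 'rV[R]_n | (w <= v)%MS] `<=` tangent_space k M c y].

(* Main.v *)
Require Import Defs.
From mathcomp Require Import all_boot all_order all_algebra.
From mathcomp Require Import all_classical all_reals all_analysis.
From mathcomp Require Import perm ring lra zify.
Set Implicit Arguments.
Unset Strict Implicit.
Unset Printing Implicit Defensive.
Import Order.TTheory GRing.Theory Num.Theory.
Import numFieldNormedType.Exports.
Local Open Scope classical_set_scope.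
Local Open Scope ring_scope.

(** The zeros of [f] are minima, so in a chart [c] at [x] the row [h] of the
    partial derivatives of [f] vanishes along the whole zero set.  Let [H] be
    the Jacobian matrix of [h] at [x], that is, the Hessian of [f].  As many
    combinations of the components of [h] as the rank of [H] have independent
    differentials at [x]; completed by linear coordinates they form a map [Phi]
    with invertible Jacobian ([rank_normal_form]).  By the inverse function
    theorem ([inverse_function]) [Phi] turns [c] into another chart of the
    maximal atlas ([sub_chart]), and the zero set lies in the slice [M] of this
    chart on which the chosen combinations vanish.  The tangent space of [M] at
    [x] is the kernel of [H].

    At a critical point the derivative of the gradient along [w] is [w *m H] up
    to the metric ([levi_civita_gradient0]).  Hence the [phi]-Hessian of [f]
    would vanish on a [phi]-plane contained in the kernel of [H], which strict
    plurisubharmonicity excludes: [M] is [phi]-free at [x].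

    Being [phi]-free is an open condition, because the Grassmannian is compact
    ([no_plane_near]).  The frames [v] with Gram determinant 1 do not form a
    compact set, but a frame [v] can be replaced by a frame [a *m v] of the same
    plane which is orthonormal for the standard scalar product
    ([gram_schmidt]).  This multiplies [phi] by [\det a] ([alternating_trig])
    and the Gram determinant by its square, so that what survives of the two
    normalizations is the equation between the square of [phi] and the Gram
    determinant.  This equation is continuous in the point and the frame, and
    orthonormal frames do form a compact set.

    The inverse function theorem is obtained without iteration.  After
    normalizing the Jacobian, the map [G] differs from the identity by a
    1/2-Lipschitz map on a closed ball.  A point minimizing the distance of
    [G z] to [y] over this compact ball is a solution of [G z = y], since one
    Newton step would otherwise improve it.  The inverse is smooth because its
    derivative is the inverse matrix of the Jacobian of [G] at the value of the
    inverse, so that being C^k implies being C^(k+1). *)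

(** * Calculus of C^k maps *)

Section Calculus.
Context {R : realType}.

(** The definition of differentiability by a little-o, in terms of epsilons:
    this lemma and [diff_bound] are the two directions. *)
Lemma is_diff_approx (V W : normedModType R) (f : V -> W) (L : {linear V -> W})
    (x : V) : continuous L ->
  (forall e : R, 0 < e ->
    \forall h \near 0, `|f (h + x) - f x - L h| <= e * `|h|) ->
  is_diff x f L.
Proof.
move=> Lc Hf.
have H : f \o shift x = cst (f x) + L +o_ 0 id.
  apply/eqaddoP => e e0; apply: filterS (Hf _ e0) => h /=.
  by rewrite !fctE /= opprD addrA.
have E := diff_unique Lc H.
apply: DiffDef => //; apply/diff_locallyP; rewrite E; split => //.
Qed.

Lemma diff_bound (V W : normedModType R) (f : V -> W) (x : V) :
  differentiable f x ->
  forall e : R, 0 < e ->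
    \forall h \near 0, `|f (h + x) - f x - 'd f x h| <= e * `|h|.
Proof.
move=> /diff_locally /eqaddoP H e e0; apply: filterS (H _ e0) => h /=.
by rewrite !fctE /= opprD addrA.
Qed.

Lemma near_eq_differentiable (V W : normedModType R) (f g : V -> W) (x : V) :
  (\near x, f x = g x) -> differentiable f x -> differentiable g x.
Proof.
move=> fg df.
have Lc := diff_continuous df.
suff /(is_diff_approx Lc) [] : forall e : R, 0 < e ->
  \forall h \near 0, `|g (h + x) - g x - 'd f x h| <= e * `|h| by [].
move=> e e0.
have fgx := nbhs_singleton fg.
move: fg; rewrite (near_shift 0) /= subr0 => fg.
near=> h.
have -> : g (h + x) = f (h + x) by apply/esym; near: h; exact: fg.
rewrite -fgx; near: h; exact: diff_bound.
Unshelve. all: by end_near. Qed.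

(** Calculus of matrix-valued maps is reduced to their entries; this
    decomposition makes the converse half of that reduction work. *)
Lemma mx_sum_entries m n (M : 'M[R]_(m, n)) :
  M = \sum_(ij : 'I_m * 'I_n) M ij.1 ij.2 *: delta_mx ij.1 ij.2.
Proof. by rewrite [LHS]matrix_sum_delta pair_bigA. Qed.

Lemma differentiable_sumT (V W : normedModType R) (I : Type) (r : seq I) (F : I -> V -> W)
    (x : V) : (forall i, differentiable (F i) x) ->
  differentiable (fun z => \sum_(i <- r) F i z) x.
Proof.
move=> H; elim: r => [|i r IH].
  under eq_fun do rewrite big_nil. exact: differentiable_cst.
under eq_fun do rewrite big_cons. exact: differentiableD.
Qed.

Lemma differentiable_mxP (V : normedModType R) m n (h : V -> 'M[R]_(m, n)) x :
  differentiable h x <-> forall i j, differentiable (fun z => h z i j) x.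
Proof.
split=> H.
  move=> i j; apply: (@differentiable_comp _ _ _ _ h (fun M : 'M[R]_(m, n) => M i j)) => //.
  exact: differentiable_coord.
rewrite (_ : h = fun z => \sum_(ij : 'I_m * 'I_n) h z ij.1 ij.2 *: delta_mx ij.1 ij.2).
  apply: differentiable_sumT => -[i j] /=; exact: differentiableZl.
by apply/funext => z; rewrite -mx_sum_entries.
Qed.

Lemma derive_mxE (V : normedModType R) m n (h : V -> 'M[R]_(m, n)) x v i j :
  differentiable h x -> 'D_v h x i j = 'D_v (fun z => h z i j) x.
Proof. by move=> /diff_derivable dh; rewrite derive_mx ?mxE. Qed.

Lemma continuous_mxP (T : topologicalType) m n (h : T -> 'M[R]_(m, n)) x :
  {for x, continuous h} <-> forall i j, {for x, continuous (fun z => h z i j)}.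
Proof.
split=> H.
  move=> i j; apply: (@continuous_comp _ _ _ h (fun M : 'M[R]_(m, n) => M i j)) => //.
  exact: coord_continuous.
move=> A [B BM BA]; have : \forall z \near x, forall i j, B i j (h z i j).
  apply: filter_forall => i; apply: filter_forall => j; exact: H.
by apply: filterS => z Bz; apply: BA.
Qed.

End Calculus.

Section Ck.
Context {R : realType} {n : nat}.
Implicit Types (O : set 'rV[R]_n).

Lemma Ck_onS (V : normedModType R) k O O' (h : 'rV[R]_n -> V) :
  O' `<=` O -> Ck_on k O h -> Ck_on k O' h.
Proof.
move=> OO; elim: k h => [|k IH] h /=; first by move=> H u /OO /H.
by move=> [H1 H2]; split=> [u /OO /H1|w]; [| exact: IH].
Qed.

Lemma Ck_on_succ (V : normedModType R) k O (h : 'rV[R]_n -> V) :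
  Ck_on k.+1 O h -> Ck_on k O h.
Proof.
elim: k h => [|k IH] h; first by move=> [H _] u /H; exact: differentiable_continuous.
by move=> [H1 H2]; split=> // w; apply: IH.
Qed.

(** Derivatives are local, so openness of [O] lets values outside [O] be
    ignored; all formulas for derivatives below hold on [O] only. *)
Lemma eq_Ck_on (V : normedModType R) k O (h h' : 'rV[R]_n -> V) :
  open O -> (forall u, O u -> h u = h' u) -> Ck_on k O h -> Ck_on k O h'.
Proof.
move=> oO; elim: k h h' => [|k IH] h h' E; have EE u : O u -> \near u, h u = h' u.
- by move=> Ou; apply: filterS (open_nbhs_nbhs (conj oO Ou)); exact: E.
- move=> H u Ou; suff : h' z @[z --> u] --> h' u by [].
  by rewrite -(E _ Ou); apply: (cvg_trans _ (H _ Ou));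
     apply: (@near_eq_cvg _ _ (nbhs u)); exact: EE.
- by move=> Ou; apply: filterS (open_nbhs_nbhs (conj oO Ou)); exact: E.
move=> [H1 H2]; split=> [u Ou|w].
  exact: near_eq_differentiable (EE _ Ou) (H1 _ Ou).
apply: IH (H2 w) => u Ou; exact: near_eq_derive (EE _ Ou).
Qed.

Lemma Ck_on_cst (V : normedModType R) k O (a : V) : Ck_on k O (cst a).
Proof.
elim: k a => [|k IH] a; first by move=> u _; exact: cst_continuous.
split=> [u _|w]; first exact: differentiable_cst.
rewrite (_ : (fun u => _) = cst 0); first exact: IH.
by apply/funext => u; rewrite derive_cst.
Qed.

Lemma Ck_onD (V : normedModType R) k O (h h' : 'rV[R]_n -> V) : open O ->
  Ck_on k O h -> Ck_on k O h' -> Ck_on k O (fun u => h u + h' u).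
Proof.
move=> oO; elim: k h h' => [|k IH] h h'.
  by move=> H H' u Ou; apply: continuousD; [exact: H|exact: H'].
move=> [H1 H2] [H1' H2']; split=> [u Ou|w].
  by apply: differentiableD; [exact: H1|exact: H1'].
apply: (eq_Ck_on oO _ (IH _ _ (H2 w) (H2' w))) => u Ou.
by rewrite -deriveD //; apply/diff_derivable; [exact: H1|exact: H1'].
Qed.

Lemma Ck_on_sum (V : normedModType R) k O (I : Type) (r : seq I)
    (h : I -> 'rV[R]_n -> V) : open O ->
  (forall i, Ck_on k O (h i)) -> Ck_on k O (fun u => \sum_(i <- r) h i u).
Proof.
move=> oO H; elim: r => [|i r IH].
  under eq_fun do rewrite big_nil. exact: Ck_on_cst.
under eq_fun do rewrite big_cons. exact: Ck_onD.
Qed.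

Lemma Ck_onM k O (h h' : 'rV[R]_n -> R) : open O ->
  Ck_on k O h -> Ck_on k O h' -> Ck_on k O (fun u => h u * h' u).
Proof.
move=> oO; elim: k h h' => [|k IH] h h'.
  by move=> H H' u Ou; apply: continuousM; [exact: H|exact: H'].
move=> /[dup] /Ck_on_succ H0 [H1 H2] /[dup] /Ck_on_succ H0' [H1' H2'].
split=> [u Ou|w].
  by apply: differentiableM; [exact: H1|exact: H1'].
apply: (eq_Ck_on oO _ (Ck_onD oO (IH _ _ H0 (H2' w)) (IH _ _ H0' (H2 w)))) => u Ou.
by rewrite -deriveM //; apply/diff_derivable; [exact: H1|exact: H1'].
Qed.

Lemma Ck_on_prod k O (I : Type) (r : seq I) (h : I -> 'rV[R]_n -> R) : open O ->
  (forall i, Ck_on k O (h i)) -> Ck_on k O (fun u => \prod_(i <- r) h i u).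
Proof.
move=> oO H; elim: r => [|i r IH].
  under eq_fun do rewrite big_nil. exact: Ck_on_cst.
under eq_fun do rewrite big_cons. exact: Ck_onM.
Qed.

Lemma Ck_onV k O (h : 'rV[R]_n -> R) : open O -> (forall u, O u -> h u != 0) ->
  Ck_on k O h -> Ck_on k O (fun u => (h u)^-1).
Proof.
move=> oO h0; elim: k h h0 => [|k IH] h h0.
  by move=> H u Ou; apply: continuousV; [exact: h0|exact: H].
move=> /[dup] /Ck_on_succ H0 [H1 H2].
split=> [u Ou|w]; first by apply: differentiableV; [exact: H1|exact: h0].
have Hi := IH _ h0 H0.
have := Ck_onM oO (Ck_onM oO (Ck_on_cst k O (-1 : R)) (Ck_onM oO Hi Hi)) (H2 w).
apply: (eq_Ck_on oO) => u Ou.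
rewrite deriveV ?h0 //; last exact/diff_derivable/H1.
by rewrite /cst mulN1r -invfM -expr2.
Qed.

Lemma Ck_on_mxP m q k O (h : 'rV[R]_n -> 'M[R]_(m, q)) : open O ->
  Ck_on k O h <-> forall i j, Ck_on k O (fun u => h u i j).
Proof.
move=> oO; elim: k h => [|k IH] h /=.
  split=> [H i j u /H /continuous_mxP|H u Ou]; first exact.
  by apply/continuous_mxP => i j; exact: H.
split=> [[H1 H2] i j|H].
  split=> [u /H1 /differentiable_mxP //|w].
  have /IH/(_ i j) := H2 w; apply: (eq_Ck_on oO) => u Ou.
  by rewrite derive_mxE //; exact: H1.
have H1 u : O u -> differentiable h u.
  by move=> Ou; apply/differentiable_mxP => i j; have [D _] := H i j; exact: D.
split=> // w; apply/IH => i j; have [_ /(_ w)] := H i j.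
by apply: (eq_Ck_on oO) => u Ou; rewrite derive_mxE //; exact: H1.
Qed.

Lemma Ck_on_coord k O j : Ck_on k O (fun u : 'rV[R]_n => u 0 j).
Proof.
case: k => [|k]; first by move=> u _; exact: coord_continuous.
split=> [u _|w]; first exact: differentiable_coord.
rewrite (_ : (fun u => _) = cst (w 0 j)); first exact: Ck_on_cst.
apply/funext => u; rewrite -(derive_mxE (h := id)) ?derive_id //.
Qed.

Lemma Ck_on_id k O : open O -> Ck_on k O (fun u : 'rV[R]_n => u).
Proof.
by move=> oO; apply/(Ck_on_mxP _ _ oO) => i j; rewrite (ord1 i); exact: Ck_on_coord.
Qed.

Lemma Ck_on_mulmx m q r k O (h : 'rV[R]_n -> 'M[R]_(m, q))
    (h' : 'rV[R]_n -> 'M[R]_(q, r)) : open O ->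
  Ck_on k O h -> Ck_on k O h' -> Ck_on k O (fun u => h u *m h' u).
Proof.
move=> oO /(Ck_on_mxP _ _ oO) H /(Ck_on_mxP _ _ oO) H'; apply/(Ck_on_mxP _ _ oO) => i j.
under eq_fun do rewrite mxE.
by apply: Ck_on_sum => // l; apply: Ck_onM.
Qed.

Lemma Ck_on_det m k O (h : 'rV[R]_n -> 'M[R]_m) : open O ->
  Ck_on k O h -> Ck_on k O (fun u => \det (h u)).
Proof.
move=> oO /(Ck_on_mxP _ _ oO) H.
rewrite /determinant; apply: Ck_on_sum => // s.
apply: Ck_onM => //; first exact: Ck_on_cst.
by apply: Ck_on_prod.
Qed.

(** By Cramer's rule the entries of the inverse are cofactors divided by the
    determinant. *)
Lemma Ck_on_invmx m k O (h : 'rV[R]_n -> 'M[R]_m) : open O ->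
  (forall u, O u -> h u \in unitmx) ->
  Ck_on k O h -> Ck_on k O (fun u => invmx (h u)).
Proof.
move=> oO h0 H; apply/(Ck_on_mxP _ _ oO) => i j.
have Hd : Ck_on k O (fun u => (\det (h u))^-1).
  apply: Ck_onV (Ck_on_det oO H) => // u /h0; by rewrite unitmxE unitfE.
have Ha : Ck_on k O (fun u => \adj (h u) i j).
  under eq_fun do rewrite mxE.
  rewrite /cofactor; apply: Ck_onM => //; first exact: Ck_on_cst.
  apply: Ck_on_det => //; apply/(Ck_on_mxP _ _ oO) => a b.
  under eq_fun do rewrite !mxE; by move/(Ck_on_mxP _ _ oO): H.
apply: (eq_Ck_on oO _ (Ck_onM oO Hd Ha)) => u /h0 hu.
by rewrite /invmx hu [RHS]mxE.
Qed.

End Ck.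

Section Composition.
Context {R : realType}.

Lemma derive_comp n m (V : normedModType R) (h : 'rV[R]_m -> V)
    (t : 'rV[R]_n -> 'rV[R]_m) u w :
  differentiable t u -> differentiable h (t u) ->
  'D_w (h \o t) u = 'D_('D_w t u) h (t u).
Proof.
move=> dt dh; rewrite !deriveE //; last exact: differentiable_comp.
by rewrite diff_comp.
Qed.

Lemma derive_row n (V : normedModType R) (h : 'rV[R]_n -> V) u w :
  differentiable h u -> 'D_w h u = \sum_j w 0 j *: 'D_(delta_mx 0 j) h u.
Proof.
move=> dh; rewrite deriveE // {1}(row_sum_delta w) linear_sum.
by apply: eq_bigr => j _; rewrite linearZ deriveE.
Qed.

(** Induction on [k]: the chain rule writes the derivative of [h \o t] as a sum
    of products of derivatives of [t] with partial derivatives of [h] composed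
    with [t], to which the induction hypothesis applies. *)
Lemma Ck_on_comp n m k (O : set 'rV[R]_n) (O' : set 'rV[R]_m) (h : 'rV[R]_m -> R)
    (t : 'rV[R]_n -> 'rV[R]_m) : open O -> open O' -> (forall u, O u -> O' (t u)) ->
  Ck_on k O t -> Ck_on k O' h -> Ck_on k O (h \o t).
Proof.
move=> oO oO' tO; elim: k h => [|k IH] h.
  move=> H H' u Ou; apply: continuous_comp; first exact: H.
  exact/H'/tO.
move=> /[dup] /Ck_on_succ H0 [H1 H2] [H1' H2']; split=> [u Ou|w].
  by apply: differentiable_comp; [exact: H1|apply: H1'; exact: tO].
have : Ck_on k O (fun u => \sum_j 'D_w t u 0 j * ((fun z => 'D_(delta_mx 0 j) h z) \o t) u).
  apply: Ck_on_sum => // j; apply: Ck_onM => //; last exact: (IH _ H0 (H2' _)).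
  by move/(Ck_on_mxP _ _ oO): (H2 w).
apply: (eq_Ck_on oO) => u Ou.
have dt := H1 _ Ou; have dh := H1' _ (tO _ Ou).
by rewrite (derive_comp _ dt dh) (derive_row _ dh).
Qed.

Lemma Ck_on_compmx n m q r k (O : set 'rV[R]_n) (O' : set 'rV[R]_m) (h : 'rV[R]_m -> 'M[R]_(q, r))
    (t : 'rV[R]_n -> 'rV[R]_m) : open O -> open O' -> (forall u, O u -> O' (t u)) ->
  Ck_on k O t -> Ck_on k O' h -> Ck_on k O (h \o t).
Proof.
move=> oO oO' tO Ht /(Ck_on_mxP _ _ oO') Hh; apply/(Ck_on_mxP _ _ oO) => i j.
exact: (Ck_on_comp oO oO' tO Ht (Hh i j)).
Qed.

End Composition.

(** * The inverse function theorem *)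

Section RowNorm.
Context {R : realType}.

Lemma ler_coord_norm n (u : 'rV[R]_n) j : `|u 0 j| <= `|u|.
Proof.
rewrite [leRHS]/Num.Def.normr/= mx_normrE.
exact: (le_bigmax _ (fun ij : 'I_1 * 'I_n => `|u ij.1 ij.2|) (0, j)).
Qed.

Lemma row_norm_le n (u : 'rV[R]_n) e : 0 <= e -> (forall j, `|u 0 j| <= e) -> `|u| <= e.
Proof.
move=> e0 H; rewrite /Num.Def.normr/= mx_normrE (bigmax_le _ e0) //= => -[i j] _.
by rewrite (ord1 i); exact: H.
Qed.

Lemma mulmxr_continuous m n q (B : 'M[R]_(n, q)) :
  continuous (fun A : 'M[R]_(m, n) => A *m B).
Proof.
move=> A; apply/continuous_mxP => i j.
suff D : differentiable (fun A : 'M[R]_(m, n) => (A *m B) i j) A.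
  exact: differentiable_continuous D.
under eq_fun do rewrite mxE.
apply: differentiable_sumT => l.
apply: differentiableM; first exact: differentiable_coord.
exact: differentiable_cst.
Qed.

(** The two difference quotients are the same function; this brings theorems on
    functions of one real variable to bear on directional derivatives. *)
Lemma is_derive_line n (V : normedModType R) (h : 'rV[R]_n -> V) (u w : 'rV[R]_n) (s : R) :
  differentiable h (s *: w + u) ->
  is_derive s 1 (fun s => h (s *: w + u)) ('D_w h (s *: w + u)).
Proof.
move=> /diff_derivable dh; have {dh} := dh w.
have E : (fun t : R => t^-1 *: (h ((t *: (1 : R) + s) *: w + u) - h (s *: w + u)))
  = (fun t => t^-1 *: (h (t *: w + (s *: w + u)) - h (s *: w + u))).
  apply/funext => t; congr (_ *: (h _ - _)).
  by rewrite addrA -scalerDl -[t *: 1]/(t * 1) mulr1.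
by move=> dh; apply: DeriveDef; rewrite /derivable /derive E.
Qed.

(** Mean value theorem on the segment from [u'] to [u], which stays in the ball.
    The factor [n] comes from bounding the derivative along [u - u'] by the sum
    of its [n] coordinates, the norm being the maximum norm. *)
Lemma mean_value_row n (h : 'rV[R]_n -> R) (u0 : 'rV[R]_n) (eps c : R) :
  0 <= c ->
  (forall z, `|z - u0| <= eps -> differentiable h z) ->
  (forall z j, `|z - u0| <= eps -> `|'D_(delta_mx 0 j) h z| <= c) ->
  forall u u', `|u - u0| <= eps -> `|u' - u0| <= eps ->
  `|h u - h u'| <= n%:R * c * `|u - u'|.
Proof.
move=> c0 dh bh u u' uK u'K.
pose w := u - u'.
have lineK s : s \in `[0, 1]%R -> `|(s *: w + u') - u0| <= eps.
  rewrite in_itv /= => /andP[s0 s1].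
  have -> : s *: w + u' - u0 = s *: (u - u0) + (1 - s) *: (u' - u0).
    by apply/rowP => j; rewrite !mxE; ring.
  apply: le_trans (ler_normD _ _) _; rewrite !normrZ ger0_norm // ger0_norm ?subr_ge0 //.
  have -> : eps = s * eps + (1 - s) * eps by ring.
  by rewrite lerD // ler_wpM2l // subr_ge0.
have [] := @MVT_segment R (fun s => h (s *: w + u')) (fun s => 'D_w h (s *: w + u')) 0 1 ler01.
- by move=> s /subset_itv_oo_cc /lineK /dh; exact: is_derive_line.
- apply: derivable_within_continuous => s /lineK /dh H.
  by have [] := is_derive_line H.
move=> s /lineK sK; rewrite scale1r scale0r add0r subrK subr0 mulr1 => ->.
rewrite derive_row; last exact: dh.
apply: le_trans (ler_norm_sum _ _ _) _.
have -> : n%:R * c * `|w| = \sum_(j < n) c * `|w|.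
  by rewrite sumr_const card_ord -[RHS]mulr_natl mulrA.
apply: ler_sum => j _; rewrite -[_ *: _]/(_ * _) normrM mulrC.
by apply: ler_pM => //; [exact: bh|exact: ler_coord_norm].
Qed.

End RowNorm.

Section InverseFunction.
Context {R : realType} {n : nat}.

Lemma smooth_jacobian (O : set 'rV[R]_n) m (G : 'rV[R]_n -> 'rV[R]_m) : open O ->
  smooth_on O G -> smooth_on O (fun u => 'J G u).
Proof.
move=> oO sG k; apply/(Ck_on_mxP _ _ oO) => i j.
have [dG /(_ (delta_mx 0 i)) /(Ck_on_mxP _ _ oO) /(_ 0 j)] := sG k.+1.
apply: (eq_Ck_on oO) => u Ou.
by rewrite deriveEjacobian ?rowE -?rowE ?mxE //; exact: dG.
Qed.

Section NearIdentity.
Variables (G : 'rV[R]_n -> 'rV[R]_n) (u0 : 'rV[R]_n) (eps : R).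
Hypothesis eps0 : 0 < eps.
Hypothesis G_cont : forall z, `|z - u0| <= eps -> {for z, continuous G}.
Hypothesis G_contr : forall u u', `|u - u0| <= eps -> `|u' - u0| <= eps ->
  `|(u - G u) - (u' - G u')| <= 2^-1 * `|u - u'|.

Lemma near_identity_expand u u' : `|u - u0| <= eps -> `|u' - u0| <= eps ->
  `|u - u'| <= 2 * `|G u - G u'|.
Proof.
move=> uK u'K; have H := G_contr uK u'K.
have E : u - u' = (G u - G u') + ((u - G u) - (u' - G u')).
  by apply/rowP => j; rewrite !mxE; ring.
have : `|u - u'| <= `|G u - G u'| + 2^-1 * `|u - u'|.
  by rewrite {1}E; apply: le_trans (ler_normD _ _) _; rewrite lerD2l.
lra.
Qed.

(** Take [u1] minimizing the distance of [G z] to [y] on the closed ball.  The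
    Newton step [u2] from [u1] stays in the ball and is at most half as far from
    [y] as [u1]; hence the distance is zero. *)
Lemma near_identity_onto y : `|y - G u0| < eps / 2 ->
  exists2 u, `|u - u0| < eps & G u = y.
Proof.
move=> yV.
have cK : compact [set z : 'rV[R]_n | `|z - u0| <= eps].
  have -> : [set z : 'rV[R]_n | `|z - u0| <= eps] = closed_ball_ (fun x => `|x|) u0 eps.
    by apply/seteqP; split => z /=; rewrite distrC.
  rewrite -closed_ballE //; apply: bounded_closed_compact; last exact: closed_ball_closed.
  rewrite closed_ballE //; exists (`|u0| + eps); split; first exact: num_real.
  move=> M lM z /= zK; apply: le_trans (ltW lM).
  have -> : z = u0 - (u0 - z) by rewrite subKr.
  by apply: le_trans (ler_normB _ _) _; rewrite lerD2l.
have u0K : `|u0 - u0| <= eps by rewrite subrr normr0 ltW.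
have [||u1 /set_mem /= u1K umin] := compact_EVT_min _ cK (f := fun z => `|G z - y|).
- by exists u0.
- apply: continuous_in_subspaceT => z /set_mem /= zK.
  apply: (@continuous_comp _ _ _ (fun z => G z - y) (fun x => `|x|)); last exact: norm_continuous.
  apply: continuousB; first exact: G_cont.
  exact: cst_continuous.
pose u2 := u1 - (G u1 - y).
have u2K : `|u2 - u0| <= eps.
  have -> : u2 - u0 = (y - G u0) + ((u1 - G u1) - (u0 - G u0)).
    by apply/rowP => j; rewrite !mxE; ring.
  apply: le_trans (ler_normD _ _) _.
  have := G_contr u1K u0K; lra.
have := umin u2; rewrite inE => /(_ u2K).
have -> : G u2 - y = (u1 - G u1) - (u2 - G u2).
  by apply/rowP => j; rewrite !mxE; ring.
have := G_contr u1K u2K; rewrite /u2 subKr => H1 H2.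
have /eqP : `|G u1 - y| = 0 by apply/eqP; rewrite eq_le normr_ge0 andbT; lra.
rewrite normr_eq0 subr_eq0 => /eqP Gu1; exists u1 => //.
have := G_contr u1K u0K.
have := ler_normD (y - G u0) ((u1 - G u1) - (u0 - G u0)).
have -> : (y - G u0) + ((u1 - G u1) - (u0 - G u0)) = u1 - u0.
  by rewrite Gu1; apply/rowP => j; rewrite !mxE; ring.
lra.
Qed.

End NearIdentity.

(** The partial derivatives of [x - G x] vanish at [u0] and are continuous. *)
Lemma derive_coord_small (O : set 'rV[R]_n) (G : 'rV[R]_n -> 'rV[R]_n) u0 c :
  open O -> O u0 -> smooth_on O G -> (forall w, 'D_w G u0 = w) -> 0 < c ->
  exists2 eps : R, 0 < eps & forall z, `|z - u0| <= eps -> O z /\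
    forall i j, `|'D_(delta_mx 0 j) (fun x => x - G x) z 0 i| <= c.
Proof.
move=> oO Ou0 sG DG c0.
have dG z : O z -> differentiable G z by have [dG _] := sG 1 => /dG.
have dr z : O z -> differentiable (fun x => x - G x) z.
  by move=> Oz; apply: differentiableB => //; exact: dG.
have Dr z w : O z -> 'D_w (fun x => x - G x) z = w - 'D_w G z.
  move=> Oz; rewrite deriveB //; first by rewrite derive_id.
  by apply: diff_derivable; exact: dG.
have near_small : \forall z \near u0, O z /\
    forall i j, `|'D_(delta_mx 0 j) (fun x => x - G x) z 0 i| <= c.
  near=> z.
  have Oz : O z by near: z; exact: open_nbhs_nbhs.
  split=> // i j; rewrite Dr //.
  move: i j; near: z; apply: filter_forall => i; apply: filter_forall => j.
  have [_ /(_ (delta_mx 0 j)) /(_ _ Ou0) /continuous_mxP /(_ 0 i)] := sG 1.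
  move=> /cvgrPdist_le /(_ c c0); apply: filterS => z.
  by rewrite DG !mxE.
have [e /= e0 He] := (nbhs_ballP _ _).1 near_small.
exists (e / 2); first by rewrite divr_gt0.
move=> z zK; apply: He; rewrite -ball_normE /= distrC; apply: le_lt_trans zK _; lra.
Unshelve. all: by end_near. Qed.

(** [N] is the part of an open ball that [G] maps into a ball of half the
    radius: [near_identity_onto] makes the image exactly that smaller ball, hence
    open, and [near_identity_expand] makes the inverse 2-Lipschitz. *)
Lemma inverse_function_id (O : set 'rV[R]_n) (G : 'rV[R]_n -> 'rV[R]_n) u0 :
  open O -> O u0 -> smooth_on O G -> (forall w, 'D_w G u0 = w) ->
  exists (N : set 'rV[R]_n) (Psi : 'rV[R]_n -> 'rV[R]_n),
    [/\ open N /\ N u0, N `<=` O, open (G @` N),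
        forall u, N u -> Psi (G u) = u & smooth_on (G @` N) Psi].
Proof.
move=> oO Ou0 sG DG.
(* Summed over [n] coordinates this constant stays below 1/2; the successor
   keeps it positive when [n] is zero. *)
have c0 : 0 < (2 * (n.+1)%:R)^-1 :> R by rewrite invr_gt0 mulr_gt0 // ltr0n.
have [eps eps0 Heps] := derive_coord_small oO Ou0 sG DG c0.
have dG z : O z -> differentiable G z by have [dG _] := sG 1 => /dG.
have KO z : `|z - u0| <= eps -> O z by move=> /Heps [].
have dr z : O z -> differentiable (fun x => x - G x) z.
  by move=> Oz; apply: differentiableB => //; exact: dG.
have G_cont z : `|z - u0| <= eps -> {for z, continuous G}.
  by move=> /KO /dG; exact: differentiable_continuous.
have G_contr u u' : `|u - u0| <= eps -> `|u' - u0| <= eps ->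
    `|(u - G u) - (u' - G u')| <= 2^-1 * `|u - u'|.
  move=> uK u'K; apply: row_norm_le => [|i]; first by rewrite mulr_ge0 // invr_ge0.
  rewrite mxE [X in _ + X]mxE.
  apply: le_trans (mean_value_row (h := fun x => (x - G x) 0 i) (ltW c0) _ _ uK u'K) _.
  - by move=> z zK; apply: ((differentiable_mxP _ _).1 (dr z (KO z zK))).
  - move=> z j zK; rewrite -(derive_mxE (h := fun x => x - G x)); last exact/dr/KO.
    by have [_] := Heps z zK; exact.
  - rewrite ler_wpM2r // invfM mulrCA ler_piMr ?invr_ge0 //.
    by rewrite ler_pdivrMr ?ltr0n // mul1r ler_nat.
have expand := near_identity_expand G_contr.
have onto := near_identity_onto eps0 G_cont G_contr.
pose N : set 'rV[R]_n := [set z | `|z - u0| < eps /\ `|G z - G u0| < eps / 2].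
have NK z : N z -> `|z - u0| <= eps by move=> [/ltW].
have GN : G @` N = [set y | `|y - G u0| < eps / 2].
  apply/seteqP; split=> [y [u [_ uN] <-] //|y /[dup] yV /onto [u uK Gu]].
  by exists u => //; split=> //; rewrite Gu.
have oball (v : 'rV[R]_n) e : open [set y | `|y - v| < e].
  rewrite (_ : mkset _ = ball v e); first exact: ball_open.
  by rewrite -ball_normE; apply/seteqP; split => z /=; rewrite distrC.
have oN : open N.
  rewrite openE => z Nz; have [z1 z2] := Nz.
  have n1 := open_nbhs_nbhs (conj (oball _ _) z1).
  have n2 := G_cont z (NK z Nz) _ (open_nbhs_nbhs (conj (oball (G u0) (eps / 2)) z2)).
  exact: filterI n1 n2.
have oV : open (G @` N) by rewrite GN.
pose Psi y := xget u0 [set u | N u /\ G u = y].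
have PsiP y : (G @` N) y -> N (Psi y) /\ G (Psi y) = y.
  by move=> [u Nu Gu]; apply: (@xgetPex _ u0 [set u | N u /\ G u = y]); exists u.
have PsiK u : N u -> Psi (G u) = u.
  move=> Nu; have [NP GP] := PsiP (G u) (ex_intro2 _ _ u Nu erefl).
  have := expand _ _ (NK _ NP) (NK _ Nu).
  by rewrite GP subrr normr0 mulr0 normr_le0 subr_eq0 => /eqP.
have PsiL y y' : (G @` N) y -> (G @` N) y' -> `|Psi y - Psi y'| <= 2 * `|y - y'|.
  move=> /PsiP [Ny Gy] /PsiP [Ny' Gy'].
  by have := expand _ _ (NK _ Ny) (NK _ Ny'); rewrite Gy Gy'.
(* A kernel vector [w] would make [G] nearly constant along [w], against the
   expansion estimate. *)
have Junit u : N u -> 'J G u \in unitmx.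
  move=> Nu; have Ou := KO _ (NK _ Nu).
  rewrite -row_free_unit -kermx_eq0; apply/rowV0P => w /sub_kermxP.
  rewrite -deriveEjacobian ?deriveE; [|exact: dG..].
  move=> wJ; apply/eqP; apply: contrapT => /negP w0.
  have q0 : 0 < 4^-1 :> R by rewrite invr_gt0.
  have Hd := diff_bound (dG u Ou) q0.
  have n1 : \forall t \near (0 : R)^', t != 0 by exact: nbhs_dnbhs_neq.
  have lc : (fun t : R => t *: w) t @[t --> 0] --> (0 : 'rV[R]_n).
    by rewrite -(scale0r w); exact: scalel_continuous.
  have lc' : (fun t : R => t *: w + u) t @[t --> 0] --> u.
    by rewrite -[X in _ --> X](add0r u); apply: cvgD => //; exact: cvg_cst.
  have n2 := nbhs_dnbhs (lc _ Hd).
  have n3 := nbhs_dnbhs (lc' _ (open_nbhs_nbhs (conj oN Nu))).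
  have PF : ProperFilter (0 : R)^' by exact: Proper_dnbhs_numFieldType.
  have [t [t0 [/= Ht Nt]]] := @filter_ex _ (0 : R)^' PF _
    (@filterI _ (0 : R)^' _ _ _ n1 (@filterI _ (0 : R)^' _ _ _ n2 n3)).
  move: Ht; rewrite linearZ /= wJ scaler0 subr0.
  have := expand _ _ (NK _ Nt) (NK _ Nu); rewrite addrK.
  have : 0 < `|t *: w| by rewrite normr_gt0 scaler_eq0 negb_or t0.
  lra.
(* With [h] the increment of [Psi] and [k] that of its argument, [h - k *m B] is
   the error of [G] at [u] multiplied by [- B], and [h] is at most [2 * k]. *)
have PsiD y : (G @` N) y -> is_diff y Psi (mulmxr (invmx ('J G (Psi y)))).
  move=> Vy; have [Nu Gu] := PsiP _ Vy; set u := Psi y in Nu Gu *; set B := invmx _.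
  have Ju := Junit _ Nu.
  have Bc : continuous (mulmxr B : 'rV[R]_n -> _) by exact: mulmxr_continuous.
  apply: is_diff_approx => // e e0.
  have [C C0 HC] := linear_lipschitz Bc.
  have e'0 : 0 < e / (2 * C) by rewrite divr_gt0 // mulr_gt0.
  have [d /= d0 Hd] := (nbhs_ballP _ _).1 (diff_bound (dG u (KO _ (NK _ Nu))) e'0).
  have d20 : 0 < d / 2 by rewrite divr_gt0.
  have n0 : \forall k \near (0 : 'rV[R]_n), `|k| < d / 2 by apply: nbhs0_lt.
  near=> k.
  have Vk : (G @` N) (k + y).
    near: k; have : \near y, (G @` N) y by exact: open_nbhs_nbhs.
    by rewrite (near_shift 0) subr0.
  have kd : `|k| < d / 2 by near: k.
  have [Nk Gk] := PsiP _ Vk.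
  have := PsiL _ _ Vk Vy; rewrite addrK => hk.
  pose h := Psi (k + y) - u.
  have hE : h + u = Psi (k + y) by rewrite /h subrK.
  have hd : `|h| < d by apply: le_lt_trans hk _; lra.
  have := Hd h; rewrite -ball_normE /= sub0r normrN => /(_ hd).
  rewrite hE Gk Gu addrK -deriveE; last exact/dG/KO/NK.
  rewrite deriveEjacobian; last exact/dG/KO/NK.
  move=> Hh; rewrite -/h.
  have -> : h - k *m B = - ((k - h *m 'J G u) *m B).
    by rewrite mulmxBl mulmxK // opprB.
  rewrite normrN; apply: le_trans (HC _) _.
  apply: le_trans (ler_wpM2l (ltW C0) Hh) _.
  have -> : C * (e / (2 * C) * `|h|) = e / 2 * `|h| by field; rewrite gt_eqF.
  have : e / 2 * `|h| <= e / 2 * (2 * `|k|) by rewrite ler_wpM2l // ltW // divr_gt0.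
  by rewrite mulrA divfK.
exists N, Psi; split=> //.
- by split=> //; split; rewrite subrr normr0 // divr_gt0.
- by move=> z /NK /KO.
(* Smoothness of [Psi]: its derivative is expressed by [Psi] itself. *)
elim=> [|k IH].
  by move=> y /PsiD [dP _]; exact: differentiable_continuous.
split=> [y /PsiD [] //|w].
have : Ck_on k (G @` N) (fun y => w *m invmx ('J G (Psi y))).
  apply: Ck_on_mulmx => //; first exact: Ck_on_cst.
  apply: Ck_on_invmx => //; first by move=> y /PsiP [/Junit].
  apply: (Ck_on_compmx (t := Psi) (h := fun u => 'J G u) oV oO) => //.
  + by move=> y /PsiP [/NK /KO].
  + exact: smooth_jacobian.
apply: (eq_Ck_on oV) => y /PsiD [dP]; rewrite deriveE // => ->.
by [].
Unshelve. all: by end_near. Qed.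

(** Reduction to identity Jacobian by composing with the inverse matrix. *)
Theorem inverse_function (O : set 'rV[R]_n) (G : 'rV[R]_n -> 'rV[R]_n) u0 :
  open O -> O u0 -> smooth_on O G -> 'J G u0 \in unitmx ->
  exists (N : set 'rV[R]_n) (Psi : 'rV[R]_n -> 'rV[R]_n),
    [/\ open N /\ N u0, N `<=` O, open (G @` N),
        forall u, N u -> Psi (G u) = u & smooth_on (G @` N) Psi].
Proof.
move=> oO Ou0 sG Ju0; set B := invmx ('J G u0).
have Bunit : B \in unitmx by rewrite unitmx_inv.
have dG z : O z -> differentiable G z by have [dG _] := sG 1 => /dG.
pose G1 u := G u *m B.
have sG1 : smooth_on O G1.
  by move=> k; apply: Ck_on_mulmx => //; exact: Ck_on_cst.
have DG1 w : 'D_w G1 u0 = w.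
  have lB : is_diff (G u0) (mulmxr B : 'rV[R]_n -> _) (mulmxr B).
    have Bc : continuous (mulmxr B : 'rV[R]_n -> _) by exact: mulmxr_continuous.
    by apply: DiffDef; [exact: linear_differentiable|exact: diff_lin].
  have := derive_comp (h := mulmxr B) (t := G) w (dG _ Ou0) ex_diff.
  rewrite -/G1 => ->; rewrite [LHS]deriveE // diff_val /= deriveEjacobian; last exact: dG.
  by rewrite mulmxK.
have [N [Psi [oN NO oV PsiK sPsi]]] := inverse_function_id oO Ou0 sG1 DG1.
have VE : G @` N = (fun y => y *m B) @^-1` (G1 @` N).
  apply/seteqP; split=> [_ [u Nu <-]|y [u Nu]]; first by exists u.
  by move=> /(can_inj (mulmxK Bunit)) E; exists u.
have oV' : open (G @` N).
  by rewrite VE; apply: open_comp => // y _; exact: mulmxr_continuous.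
exists N, (fun y => Psi (y *m B)); split=> // k.
apply: (Ck_on_compmx (t := fun y => y *m B) oV' oV) => //.
- by rewrite VE.
- by apply: Ck_on_mulmx => //; [exact: Ck_on_id|exact: Ck_on_cst].
Qed.

End InverseFunction.

(** * Orthonormal frames and alternating forms *)

Section Orthonormal.
Context {R : realType}.

(** Block Gaussian elimination: after splitting off the first coordinate, the
    Schur complement [T] of the pivot [s] is again symmetric and positive,
    because it is the restriction of the form to the vectors orthogonal to the
    first one.  The triangular shape is what [alternating_trig] asks for. *)
Lemma cholesky p (S : 'M[R]_p) : S^T = S ->
  (forall w : 'rV[R]_p, w != 0 -> 0 < (w *m S *m w^T) 0 0) ->
  exists2 a : 'M[R]_p, is_trig_mx a & a *m S *m a^T = 1%:M.
Proof.
elim: p S => [|p IH] S Ssym Spos.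
  by exists 1%:M; [exact: scalar_mx_is_trig|apply/matrixP; case].
rewrite -[p.+1]/(1 + p)%N in S Ssym Spos *.
pose S11 := @ulsubmx _ 1 p 1 p S; pose S12 := @ursubmx _ 1 p 1 p S.
pose S21 := @dlsubmx _ 1 p 1 p S; pose S22 := @drsubmx _ 1 p 1 p S.
have SE : S = block_mx S11 S12 S21 S22 by rewrite submxK.
have [S11T S12T S22T] : [/\ S11^T = S11, S21^T = S12 & S22^T = S22].
  by move: Ssym; rewrite SE tr_block_mx => /eq_block_mx [? ? _ ?].
have quad (x : 'rV[R]_1) (y : 'rV[R]_p) :
    row_mx x y *m S *m (row_mx x y)^T =
    x *m S11 *m x^T + y *m S21 *m x^T + (x *m S12 *m y^T + y *m S22 *m y^T).
  by rewrite SE mul_row_block tr_row_mx mul_row_col !mulmxDl.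
set s := S11 0 0.
have S11E : S11 = s%:M by rewrite [LHS]mx11_scalar.
have s0 : 0 < s.
  have := Spos (delta_mx 0 (lshift p 0)); rewrite -rowE trmx_delta -colE /s !mxE; apply.
  by apply/eqP => /matrixP /(_ 0 (lshift p 0)) /eqP; rewrite !mxE !eqxx oner_eq0.
pose T := S22 - s^-1 *: (S21 *m S12).
have TT : T^T = T.
  by rewrite /T linearB linearZ /= trmx_mul -{1}S12T trmxK S12T S22T.
have Tpos (w : 'rV[R]_p) : w != 0 -> 0 < (w *m T *m w^T) 0 0.
  move=> w0; pose x := - (s^-1 *: (w *m S21)).
  have := Spos (row_mx x w); rewrite quad.
  have -> : x *m S11 = - (w *m S21).
    by rewrite S11E mul_mx_scalar scalerN scalerA divff ?scale1r // gt_eqF.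
  have xS : x *m S12 = - (s^-1 *: (w *m (S21 *m S12))).
    by rewrite /x mulNmx -scalemxAl mulmxA.
  have TE : w *m T = x *m S12 + w *m S22 by rewrite /T mulmxBr -scalemxAr xS addrC.
  rewrite mulNmx addNr add0r -mulmxDl -TE => H; apply: H.
  apply: contraNneq w0 => /matrixP H; apply/eqP/rowP => j.
  by have := H 0 (rshift 1 j); rewrite row_mxEr !mxE.
have [a' atrig aT] := IH T TT Tpos.
pose c := (Num.sqrt s)^-1.
have cs : c * s * c = 1.
  have q0 : Num.sqrt s != 0 by rewrite gt_eqF // sqrtr_gt0.
  have E : c * (Num.sqrt s * Num.sqrt s) * c = 1 by rewrite /c; field.
  by rewrite -[RHS]E -expr2 sqr_sqrtr // ltW.
exists (block_mx c%:M 0 (- (s^-1 *: (a' *m S21))) a').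
  by rewrite is_trig_block_mx // eqxx scalar_mx_is_trig atrig.
have Z : - (s^-1 *: (a' *m S21)) *m S11 + a' *m S21 = 0.
  by rewrite S11E mul_mx_scalar scalerN scalerA divff ?scale1r ?addNr // gt_eqF.
have TE : - (s^-1 *: (a' *m S21)) *m S12 + a' *m S22 = a' *m T.
  by rewrite /T mulmxBr -scalemxAr mulNmx -scalemxAl mulmxA addrC.
rewrite SE mulmx_block !mul0mx !addr0 Z TE tr_block_mx trmx0 mulmx_block.
rewrite !mul0mx !mulmx0 !addr0 !add0r aT S11E.
have -> : c%:M *m s%:M *m c%:M^T = 1%:M :> 'M[R]_1.
  by rewrite tr_scalar_mx -!scalar_mxM cs.
rewrite [RHS]scalar_mx_block; congr (block_mx _ _ _ _).
rewrite linearN linearZ /= trmx_mul S12T -scalar_mxM mul_scalar_mx mul_scalar_mx.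
by rewrite scalerN scalerA mulfK ?gt_eqF // -scalemxAl addNr.
Qed.

Lemma mul_rV_tr_gt0 n (w : 'rV[R]_n) : w != 0 -> 0 < (w *m w^T) 0 0.
Proof.
move=> w0; rewrite lt_def; apply/andP; split; last first.
  by rewrite mxE; apply: sumr_ge0 => j _; rewrite mxE -expr2 sqr_ge0.
apply: contra w0 => /eqP; rewrite mxE => H; apply/eqP/rowP => j.
have /psumr_eq0P : forall j, true -> 0 <= w 0 j * w^T j 0.
  by move=> i _; rewrite mxE -expr2 sqr_ge0.
by move=> /(_ H) /(_ j isT) /eqP; rewrite !mxE mulf_eq0 orbb => /eqP.
Qed.

Lemma gram_schmidt p n (v : 'M[R]_(p, n)) : row_free v ->
  exists2 a : 'M[R]_p, is_trig_mx a & (a *m v) *m (a *m v)^T = 1%:M.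
Proof.
move=> vfree; have [||a atrig aE] := @cholesky p (v *m v^T).
- by rewrite trmx_mul trmxK.
- move=> w w0; rewrite mulmxA -mulmxA -trmx_mul; apply: mul_rV_tr_gt0.
  by rewrite mulmx_free_eq0.
by exists a => //; rewrite trmx_mul !mulmxA -mulmxA -[in LHS]mulmxA in aE *.
Qed.

Lemma orthonormal_le1 p n (v : 'M[R]_(p, n)) i j : v *m v^T = 1%:M -> `|v i j| <= 1.
Proof.
move=> /matrixP /(_ i i); rewrite !mxE eqxx => H.
have {}H : 1 = \sum_j v i j * v^T j i by rewrite H.
rewrite -(@ler_pXn2r _ 2) ?nnegrE // expr1n [leRHS]H real_normK ?num_real //.
rewrite (bigD1 j) //= mxE -expr2 lerDl; apply: sumr_ge0 => l _.
by rewrite mxE -expr2 sqr_ge0.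
Qed.

(** A vector [w] in the kernel of the Gram matrix makes [w *m v] isotropic. *)
Lemma gram_det_neq0 p n (v : 'M[R]_(p, n)) (g : 'M[R]_n) :
  (forall w : 'rV[R]_n, w != 0 -> 0 < (w *m g *m w^T) 0 0) -> row_free v ->
  \det (v *m g *m v^T) != 0.
Proof.
move=> gpos vfree; rewrite -unitfE -unitmxE -row_free_unit -kermx_eq0.
apply/rowV0P => w /sub_kermxP wE.
apply/eqP; rewrite -(mulmx_free_eq0 _ vfree); apply/negPn/negP => /gpos.
by rewrite trmx_mul -!mulmxA [g *m _]mulmxA [v *m _]mulmxA [w *m _]mulmxA mulmxA wE mul0mx mxE ltxx.
Qed.

Lemma gram_det_neq0_free p n (v : 'M[R]_(p, n)) (g : 'M[R]_n) :
  \det (v *m g *m v^T) != 0 -> row_free v.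
Proof.
rewrite -unitfE -unitmxE -row_free_unit -!kermx_eq0 => /eqP H.
apply/rowV0P => w /sub_kermxP wE; apply/eqP; rewrite -submx0 -H.
by apply/sub_kermxP; rewrite !mulmxA wE !mul0mx.
Qed.

Lemma gram_det_mul p n (a : 'M[R]_p) (v : 'M[R]_(p, n)) (g : 'M[R]_n) :
  \det ((a *m v) *m g *m (a *m v)^T) = \det a ^+ 2 * \det (v *m g *m v^T).
Proof.
have -> : (a *m v) *m g *m (a *m v)^T = a *m (v *m g *m v^T) *m a^T.
  by rewrite trmx_mul !mulmxA.
by rewrite !det_mulmx det_tr; ring.
Qed.

End Orthonormal.

Section Alternating.
Context {R : realType} {p n : nat}.

Definition multilinear_form (f : 'M[R]_(p, n) -> R) := forall v i a w1 w2,
  f (set_row v i (a *: w1 + w2)) = a * f (set_row v i w1) + f (set_row v i w2).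
Definition alternating_form (f : 'M[R]_(p, n) -> R) := forall v (i j : 'I_p),
  i != j -> row i v = row j v -> f v = 0.

Variable f : 'M[R]_(p, n) -> R.
Hypothesis f_lin : multilinear_form f.

Lemma multilinear0 v i : f (set_row v i 0) = 0.
Proof.
have := f_lin v i 1 0 0; rewrite scaler0 addr0 mul1r => H; lra.
Qed.

Lemma multilinear_sum v i (I : Type) (r : seq I) (P : pred I) (a : I -> R) (w : I -> 'rV[R]_n) :
  f (set_row v i (\sum_(l <- r | P l) a l *: w l)) =
  \sum_(l <- r | P l) a l * f (set_row v i (w l)).
Proof.
elim/big_rec2: _ => [|l y1 y2 _ <-]; first exact: multilinear0.
exact: f_lin.
Qed.

Lemma row_set_row (v : 'M[R]_(p, n)) i j w : row j (set_row v i w) = if j == i then w else row j v.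
Proof. by apply/rowP => l; rewrite !mxE; case: eqP => // _; rewrite mxE. Qed.

Hypothesis f_alt : alternating_form f.

(** The rows of [v] are replaced by those of [a *m v] one at a time, from the
    last to the first.  Row [k] of [a *m v] combines the rows [l <= k] of [v]; as
    the rows above it are still those of [v], alternation removes all terms but
    [l = k], so that step [k] contributes the diagonal entry of [a]. *)
Lemma alternating_trig (a : 'M[R]_p) v : is_trig_mx a -> f (a *m v) = \det a * f v.
Proof.
move=> atrig; rewrite det_trig //.
pose W k : 'M[R]_(p, n) := \matrix_(i, j) if (i < k)%N then v i j else (a *m v) i j.
have W0 : W 0%N = a *m v by apply/matrixP => i j; rewrite mxE.
have Wp : W p = v by apply/matrixP => i j; rewrite mxE ltn_ord.
have step (k : 'I_p) : f (W k) = a k k * f (W k.+1).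
  have -> : W k = set_row (W k) k (\sum_l a k l *: row l v).
    apply/matrixP => i j; rewrite [RHS]mxE; case: eqP => [->|//].
    by rewrite summxE !mxE ltnn; apply: eq_bigr => l _; rewrite !mxE.
  rewrite multilinear_sum (bigD1 k) //= big1 => [|l lk].
    rewrite addr0; congr (_ * f _); apply/matrixP => i j; rewrite !mxE.
    case: (eqVneq i k) => [->|ik]; first by rewrite ltnSn.
    by rewrite [(i < k.+1)%N]ltnS [(i <= k)%N]leq_eqVlt (negPf (ik : (i != k :> nat))).
  have [kl|lk'] := leqP k l.
    rewrite (is_trig_mxP atrig) ?mul0r // ltn_neqAle kl andbT.
    by rewrite eq_sym.
  rewrite [f _](@f_alt _ k l) ?mulr0 // 1?eq_sym //.
  rewrite !row_set_row eqxx (negPf lk); apply/rowP => j; by rewrite !mxE lk'.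
have main k : (k <= p)%N -> f (W 0%N) = (\prod_(i < p | (i < k)%N) a i i) * f (W k).
  elim: k => [_|k IH kp]; first by rewrite big_pred0 ?mul1r.
  rewrite IH ?(ltnW kp) // (step (Ordinal kp)) mulrA; congr (_ * _).
  rewrite [RHS](bigD1 (Ordinal kp)) //= mulrC; congr (_ * _); apply: eq_bigl => i.
  by rewrite ltnS ltn_neqAle andbC -[i != _]/(i != k :> nat).
rewrite -W0 (main p) // Wp; congr (_ * _); apply: eq_bigl => i; by rewrite ltn_ord.
Qed.

End Alternating.

(** * Compactness of the set of planes *)

Section ContinuousMatrices.
Context {R : realType} {T : topologicalType}.

Lemma near_eq_continuous (U : topologicalType) (f g : T -> U) z0 :
  (\near z0, g z0 = f z0) -> {for z0, continuous f} -> {for z0, continuous g}.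
Proof.
move=> E fc; suff : g z @[z --> z0] --> g z0 by [].
rewrite (nbhs_singleton E).
by apply: (cvg_trans _ fc); apply: (@near_eq_cvg _ _ (nbhs z0)); apply: filterS E => z ->.
Qed.

Lemma continuous_sum (I : Type) (r : seq I) (P : pred I) (f : I -> T -> R) z0 :
  (forall i, P i -> {for z0, continuous (f i)}) ->
  {for z0, continuous (fun z => \sum_(i <- r | P i) f i z)}.
Proof.
move=> H; elim: r => [|i r IH].
  apply: (near_eq_continuous (f := cst (0 : R))); last exact: cst_continuous.
  by near=> z; rewrite big_nil.
have [Pi|Pi] := boolP (P i).
  apply: near_eq_continuous (continuousD (H _ Pi) IH).
  by near=> z; rewrite big_cons Pi.
apply: near_eq_continuous IH.
by near=> z; rewrite big_cons (negPf Pi).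
Unshelve. all: by end_near. Qed.

Lemma continuous_prod (I : Type) (r : seq I) (f : I -> T -> R) z0 :
  (forall i, {for z0, continuous (f i)}) ->
  {for z0, continuous (fun z => \prod_(i <- r) f i z)}.
Proof.
move=> H; elim: r => [|i r IH].
  apply: (near_eq_continuous (f := cst (1 : R))); last exact: cst_continuous.
  by near=> z; rewrite big_nil.
apply: near_eq_continuous (continuousM (H i) IH).
by near=> z; rewrite big_cons.
Unshelve. all: by end_near. Qed.

Lemma continuous_mulmx m n q (A : T -> 'M[R]_(m, n)) (B : T -> 'M[R]_(n, q)) z0 :
  {for z0, continuous A} -> {for z0, continuous B} ->
  {for z0, continuous (fun z => A z *m B z)}.
Proof.
move=> /continuous_mxP cA /continuous_mxP cB; apply/continuous_mxP => i j.
apply: (@near_eq_continuous _ (fun z => \sum_l A z i l * B z l j)).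
  by near=> z; rewrite mxE.
by apply: continuous_sum => l _; apply: continuousM.
Unshelve. all: by end_near. Qed.

Lemma continuous_trmx m n (A : T -> 'M[R]_(m, n)) z0 :
  {for z0, continuous A} -> {for z0, continuous (fun z => (A z)^T)}.
Proof.
move=> /continuous_mxP cA; apply/continuous_mxP => i j.
by apply: near_eq_continuous (cA j i); near=> z; rewrite mxE.
Unshelve. all: by end_near. Qed.

Lemma continuous_det n (A : T -> 'M[R]_n) z0 :
  {for z0, continuous A} -> {for z0, continuous (fun z => \det (A z))}.
Proof.
move=> /continuous_mxP cA; rewrite /determinant; apply: continuous_sum => s _.
apply: continuousM; first exact: cst_continuous.
by apply: continuous_prod.
Qed.

End ContinuousMatrices.

Lemma continuous_snd (S T U : topologicalType) (f : T -> U) (x : S) (y : T) :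
  {for y, continuous f} -> {for (x, y), continuous (fun z : S * T => f z.2)}.
Proof. by move=> fc; apply: continuous_comp fc; exact: cvg_snd. Qed.

Lemma mx_box_compact (R : realType) p n :
  compact [set v : 'M[R]_(p, n) | forall i j, `|v i j| <= 1].
Proof.
pose box : set 'rV[R]_(p * n) := [set w | forall k, `[-1, 1]%classic (w ord0 k)].
have cbox : compact box.
  by apply: (@rV_compact R _ (fun _ => `[(-1 : R), 1]%classic)) => _; exact: segment_compact.
have -> : [set v : 'M[R]_(p, n) | forall i j, `|v i j| <= 1] = vec_mx @` box.
  apply/seteqP; split=> [v Hv|_ [w Hw <-] i j].
    exists (mxvec v); last exact: mxvecK.
    move=> k; case/mxvec_indexP: k => i j; rewrite /= in_itv /= mxvecE.
    by rewrite -ler_norml.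
  by have := Hw (mxvec_index i j); rewrite /= in_itv /= -ler_norml mxE.
apply: continuous_compact cbox; apply: continuous_subspaceT => w.
apply/continuous_mxP => i j.
apply: (near_eq_continuous (f := fun w : 'rV[R]_(p * n) => w 0 (mxvec_index i j))).
  by near=> z; rewrite mxE.
exact: coord_continuous.
Unshelve. all: by end_near. Qed.

Section FormContinuity.
Context {R : realType} {p n : nat}.
Variables (F : 'rV[R]_n -> 'M[R]_(p, n) -> R) (u0 : 'rV[R]_n).
Hypothesis F_lin : \near u0, multilinear_form (F u0).
Hypothesis F_cont : forall v, {for u0, continuous (F ^~ v)}.

(** Smoothness of a form is continuity in the point for a fixed frame.  Joint
    continuity follows by making the rows of the frame variable one at a time:
    expanding one row in the standard basis reduces to one variable row less. *)
Lemma form_continuous v0 :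
  {for (v0, u0), continuous (fun z : 'M[R]_(p, n) * 'rV[R]_n => F z.2 z.1)}.
Proof.
pose mix k (x w : 'M[R]_(p, n)) : 'M[R]_(p, n) :=
  \matrix_(i, j) if (i < k)%N then x i j else w i j.
have F_lin2 : \forall z \near (v0, u0), multilinear_form (F z.2).
  exact: (cvg_snd F_lin).
suff main k : (k <= p)%N -> forall w,
    {for (v0, u0), continuous (fun z : 'M[R]_(p, n) * 'rV[R]_n => F z.2 (mix k z.1 w))}.
  apply: near_eq_continuous (main p (leqnn p) 0); near=> z; congr (F _ _).
  by apply/matrixP => i j; rewrite mxE ltn_ord.
elim: k => [_ w|k IH kp w].
  apply: (near_eq_continuous (f := fun z : 'M[R]_(p, n) * 'rV[R]_n => F z.2 w)).
    by near=> z; congr (F _ _); apply/matrixP => i j; rewrite mxE.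
  exact: (continuous_snd (f := F ^~ w)).
pose k' := Ordinal kp.
apply: (@near_eq_continuous _ _ (fun z : 'M[R]_(p, n) * 'rV[R]_n =>
  \sum_l z.1 k' l * F z.2 (mix k z.1 (set_row w k' (delta_mx 0 l))))).
  near=> z.
  have Fz : multilinear_form (F z.2) by near: z.
  have E y : set_row (mix k z.1 w) k' y = mix k z.1 (set_row w k' y).
    apply/matrixP => i j; rewrite !mxE; case: eqP => // ->; by rewrite ltnn.
  have -> : mix k.+1 z.1 w = set_row (mix k z.1 w) k' (row k' z.1).
    apply/matrixP => i j; rewrite !mxE.
    case: (eqVneq i k') => [->|ik]; first by rewrite ltnSn.
    by rewrite [(i < k.+1)%N]ltnS [(i <= k)%N]leq_eqVlt (negPf (ik : (i != k :> nat))).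
  rewrite {1}(row_sum_delta (row k' z.1)) multilinear_sum //.
  by apply: eq_bigr => l _; rewrite E mxE.
apply: continuous_sum => l _; apply: continuousM; last exact/IH/ltnW.
apply: (@continuous_comp _ _ _ (fun z : 'M[R]_(p, n) * 'rV[R]_n => z.1)
  (fun x : 'M[R]_(p, n) => x k' l)); first exact: cvg_fst.
exact: coord_continuous.
Unshelve. all: by end_near. Qed.

End FormContinuity.

Section NoPlanes.
Context {R : realType} {p n : nat}.
Variables (F : 'rV[R]_n -> 'M[R]_(p, n) -> R) (G : 'rV[R]_n -> 'M[R]_n).
Variables (D : 'rV[R]_n -> 'M[R]_n) (k : nat) (u0 : 'rV[R]_n).
Hypothesis p_gt0 : (0 < p)%N.
Hypothesis F_lin : \near u0, multilinear_form (F u0).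
Hypothesis F_alt : \near u0, alternating_form (F u0).
Hypothesis F_cont : forall v, {for u0, continuous (F ^~ v)}.
Hypothesis G_cont : {for u0, continuous G}.
Hypothesis G_pos : forall w : 'rV[R]_n, w != 0 -> 0 < (w *m G u0 *m w^T) 0 0.
Hypothesis D_cont : {for u0, continuous D}.

(** A frame of unit volume on which the form is 1 and which the matrix [D u]
    maps into the model slice.  With [F] the calibration, [G] the metric and
    [D] the Jacobian of a slice chart, these are the [phi]-planes tangent to
    the submanifold. *)
Definition plane_in_slice u (v : 'M[R]_(p, n)) :=
  [/\ \det (v *m G u *m v^T) = 1, F u v = 1 & forall a, slice k (row a (v *m D u))].

(** Where the Gram determinant is nonzero, the zeros are the orthonormal frames
    that become frames as in [plane_in_slice] when one row is rescaled.  A sum of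
    squares makes a single continuous function of these conditions. *)
Let defect (z : 'M[R]_(p, n) * 'rV[R]_n) : R :=
  \sum_(i < p) \sum_(j < p) (z.1 *m z.1^T - 1%:M) i j ^+ 2 +
  ((F z.2 z.1 ^+ 2 - \det (z.1 *m G z.2 *m z.1^T)) ^+ 2 +
  \sum_(i < p) \sum_(j < n | (k <= j)%N) (z.1 *m D z.2) i j ^+ 2).

Let defect0P z : defect z = 0 <->
  [/\ z.1 *m z.1^T = 1%:M, F z.2 z.1 ^+ 2 = \det (z.1 *m G z.2 *m z.1^T) &
      forall a, slice k (row a (z.1 *m D z.2))].
Proof.
have s0 q (A : 'M[R]_(p, q)) P : 0 <= \sum_i \sum_(j | P j) A i j ^+ 2.
  by apply: sumr_ge0 => i _; apply: sumr_ge0 => j _; exact: sqr_ge0.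
have sP q (A : 'M[R]_(p, q)) P : \sum_i \sum_(j | P j) A i j ^+ 2 = 0 <->
    forall i j, P j -> A i j = 0.
  split=> [H i j Pj|H]; last first.
    by apply: big1 => i _; apply: big1 => j Pj; rewrite H // expr0n.
  have r0 i' : true -> 0 <= \sum_(j | P j) A i' j ^+ 2.
    by move=> _; apply: sumr_ge0 => j' _; exact: sqr_ge0.
  have := psumr_eq0P r0 H (i := i) isT => {}H.
  have c0 j' : P j' -> 0 <= A i j' ^+ 2 by move=> _; exact: sqr_ge0.
  by have /eqP := psumr_eq0P c0 H Pj; rewrite sqrf_eq0 => /eqP.
rewrite /defect; set S1 := (X in X + _); set S2 := (X in _ + (X + _)); set S3 := (X in _ + (_ + X)).
have S1ge : 0 <= S1 by exact: s0.
have S2ge : 0 <= S2 by exact: sqr_ge0.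
have S3ge : 0 <= S3 by exact: s0.
split=> [H|[H1 H2 H3]].
  have [/sP H1 /eqP H2 /sP H3] : [/\ S1 = 0, S2 = 0 & S3 = 0] by split; lra.
  split.
  - apply/matrixP => i j; apply/eqP; rewrite -subr_eq0; apply/eqP.
    by have := H1 i j isT; rewrite !mxE.
  - by move: H2; rewrite /S2 sqrf_eq0 subr_eq0 => /eqP.
  - by move=> a j kj; rewrite mxE; exact: H3.
have -> : S1 = 0 by apply/sP => i j _; rewrite H1 subrr mxE.
have -> : S2 = 0 by rewrite /S2 H2 subrr expr0n.
have -> : S3 = 0.
  by apply/sP => i j kj; have := H3 i j kj; rewrite mxE.
by rewrite !addr0.
Qed.

Let defect_continuous v0 : {for (v0, u0), continuous defect}.
Proof.
have c1 : {for (v0, u0), continuous (fun z : 'M[R]_(p, n) * 'rV[R]_n => z.1)} by exact: cvg_fst.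
have cG : {for (v0, u0), continuous (fun z : 'M[R]_(p, n) * 'rV[R]_n => G z.2)}.
  exact: continuous_snd.
have cD : {for (v0, u0), continuous (fun z : 'M[R]_(p, n) * 'rV[R]_n => D z.2)}.
  exact: continuous_snd.
have cF := form_continuous F_lin F_cont (v0 := v0).
have cT := continuous_trmx c1.
have sq (h : 'M[R]_(p, n) * 'rV[R]_n -> R) :
    {for (v0, u0), continuous h} -> {for (v0, u0), continuous (fun z => h z ^+ 2)}.
  by move=> hc; exact: (continuousM hc hc).
apply: continuousD; last apply: continuousD.
- apply: continuous_sum => i _; apply: continuous_sum => j _; apply: sq.
  apply: (continuous_mxP _ _).1; apply: continuousB; first exact: continuous_mulmx.
  exact: cst_continuous.
- apply: (sq (fun z => F z.2 z.1 ^+ 2 - \det (z.1 *m G z.2 *m z.1^T))).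
  apply: continuousB; first exact: (sq (fun z => F z.2 z.1)).
  by apply: continuous_det; apply: continuous_mulmx cT; exact: continuous_mulmx.
- apply: continuous_sum => i _; apply: continuous_sum => j _; apply: sq.
  apply: (continuous_mxP _ _).1; exact: continuous_mulmx.
Qed.

Let scale_first t : 'M[R]_p := diag_mx (\row_i if i == Ordinal p_gt0 then t else 1).

Let det_scale_first t : \det (scale_first t) = t.
Proof.
rewrite det_diag (bigD1 (Ordinal p_gt0)) //= big1 ?mulr1; first by rewrite mxE eqxx.
by move=> i /negPf ip; rewrite mxE ip.
Qed.

Lemma slice_mull q (a : 'M[R]_(q, p)) (v : 'M[R]_(p, n)) :
  (forall i, slice k (row i v)) -> forall i, slice k (row i (a *m v)).
Proof.
move=> H i j kj; rewrite !mxE big1 // => l _.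
by have := H l j kj; rewrite mxE => ->; rewrite mulr0.
Qed.

(** At [u0] the defect has no zero on orthonormal frames: the Gram determinant
    there is nonzero, so dividing the first row by the value of the form would
    give a frame as in [plane_in_slice].  Compactness extends the absence of
    zeros to nearby [u], where Gram-Schmidt turns a frame as in
    [plane_in_slice] into a zero of the defect. *)
Lemma no_plane_near :
  (forall v, ~ plane_in_slice u0 v) -> \forall u \near u0, forall v, ~ plane_in_slice u v.
Proof.
move=> H0.
have nz v : defect (v, u0) != 0.
  apply/eqP => /defect0P /= [vo vF vD].
  have vfree : row_free v.
    by apply/row_freeP; exists v^T.
  have d0 := gram_det_neq0 G_pos vfree.
  have t0 : F u0 v != 0 by move: d0; rewrite -vF expf_eq0.
  apply: (H0 (scale_first (F u0 v)^-1 *m v)); split.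
  - by rewrite gram_det_mul det_scale_first -vF -exprMn mulVf // expr1n.
  - rewrite alternating_trig ?det_scale_first ?mulVf //.
    + exact: nbhs_singleton F_lin.
    + exact: nbhs_singleton F_alt.
    + exact: diag_mx_is_trig.
  - by rewrite -mulmxA; exact: slice_mull.
have cov : \forall u \near u0, [set v : 'M[R]_(p, n) | forall i j, `|v i j| <= 1] `<=`
    (fun v => defect (v, u) != 0).
  have box := (compact_near_coveringP _).1 (@mx_box_compact R p n) _ (nbhs u0)
    (fun u v => defect (v, u) != 0).
  apply: box => v _.
  have n0 : nbhs (defect (v, u0)) [set t | t != 0].
    by apply: open_nbhs_nbhs; split; [exact: open_neq|exact: nz].
  have dc : defect z @[z --> (v, u0)] --> defect (v, u0) := @defect_continuous v.
  have [[A B] /= [vA uB] AB] := dc _ n0.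
  exists (A, B) => //= -[v' u'] /= [Av' Bu']; exact: (AB (v', u')).
near=> u => v [vG vF vD].
have Flin : multilinear_form (F u) by near: u.
have Falt : alternating_form (F u) by near: u.
have vfree : row_free v by apply: (@gram_det_neq0_free _ _ _ v (G u)); rewrite vG oner_eq0.
have [a atrig ao] := gram_schmidt vfree.
have cov_u : [set v : 'M[R]_(p, n) | forall i j, `|v i j| <= 1] `<=`
    (fun v => defect (v, u) != 0) by near: u.
have /cov_u /eqP : forall i j, `|(a *m v) i j| <= 1 by move=> i j; exact: orthonormal_le1.
apply; apply/defect0P; split=> //=.
- by rewrite alternating_trig // gram_det_mul vF vG !mulr1.
- by rewrite -mulmxA; exact: slice_mull.
Unshelve. all: by end_near. Qed.

End NoPlanes.

(** * Charts, slices and tangent spaces *)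

Lemma open_preimage_on (S T : topologicalType) (D : set S) (B : set T) (h : S -> T) :
  open D -> (forall y, D y -> {for y, continuous h}) -> open B ->
  open (D `&` h @^-1` B).
Proof.
move=> oD hc oB; rewrite openE => y [Dy By].
have n1 := open_nbhs_nbhs (conj oD Dy).
have n2 := hc y Dy _ (open_nbhs_nbhs (conj oB By)).
exact: filterI n1 n2.
Qed.

Lemma jacobian_comp (R : realType) n m q (h : 'rV[R]_m -> 'rV[R]_q)
    (t : 'rV[R]_n -> 'rV[R]_m) u :
  differentiable t u -> differentiable h (t u) ->
  'J (h \o t) u = 'J t u *m 'J h (t u).
Proof.
move=> dt dh; have dc := differentiable_comp dt dh.
apply/row_matrixP => i; rewrite !rowE mulmxA -(deriveEjacobian _ dt) -(deriveEjacobian _ dh).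
by rewrite -(deriveEjacobian _ dc) derive_comp.
Qed.

Lemma near_eq_jacobian (R : realType) n m (h h' : 'rV[R]_n -> 'rV[R]_m) u :
  (\near u, h u = h' u) -> differentiable h u -> 'J h u = 'J h' u.
Proof.
move=> E dh; have dh' := near_eq_differentiable E dh.
apply/row_matrixP => i.
rewrite [LHS]rowE [RHS]rowE.
have E1 := deriveEjacobian (delta_mx 0 i) dh.
have E2 := deriveEjacobian (delta_mx 0 i) dh'.
by apply: etrans (esym E1) (etrans _ E2); exact: near_eq_derive.
Qed.

Lemma derive_mulmx (R : realType) (V : normedModType R) m q r
    (A : V -> 'M[R]_(m, q)) (B : V -> 'M[R]_(q, r)) u w :
  differentiable A u -> differentiable B u ->
  differentiable (fun z => A z *m B z) u /\
  'D_w (fun z => A z *m B z) u = 'D_w A u *m B u + A u *m 'D_w B u.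
Proof.
move=> dA dB.
have dAe := (differentiable_mxP _ _).1 dA; have dBe := (differentiable_mxP _ _).1 dB.
have E i j : (fun z => (A z *m B z) i j) = \sum_(l < q) ((fun z => A z i l) * (fun z => B z l j)).
  by apply/funext => z; rewrite mxE fct_sumE.
have dP : differentiable (fun z => A z *m B z) u.
  apply/differentiable_mxP => i j; rewrite E; apply: differentiable_sum => l.
  exact: differentiableM.
split=> //; apply/matrixP => i j; rewrite derive_mxE // E derive_sum; last first.
  by move=> l; apply: derivableM; exact: diff_derivable.
rewrite !mxE -big_split /=; apply: eq_bigr => l _.
rewrite deriveM; [|exact: diff_derivable..].
rewrite !derive_mxE // addrC; congr (_ + _).
by rewrite -[LHS]/(_ * _) mulrC.
Qed.

Section Charts.
Context {R : realType} {n : nat}.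

Section OneSpace.
Context {T : topologicalType}.
Implicit Types c d e : chart R n T.

Lemma overlap_open c d : open (overlap c d).
Proof.
apply: open_preimage_on (@open_cod _ _ _ c) _ (@open_dom _ _ _ d) => u.
exact: continuous_para.
Qed.

Lemma overlap_chart_map c d y : dom c y -> dom d y -> overlap c d (chart_map c y).
Proof. by move=> cy dy; split; [exact: chart_map_cod|rewrite /= chart_mapK]. Qed.

Lemma transition_chart_map c d y : dom c y ->
  transition c d (chart_map c y) = chart_map d y.
Proof. by move=> cy; rewrite /transition /= chart_mapK. Qed.

Lemma transition_differentiable c d y : compatible c d -> dom c y -> dom d y ->
  differentiable (transition c d) (chart_map c y).
Proof. by move=> [/(_ 1%N) [H _] _] cy dy; apply/H/overlap_chart_map. Qed.

Lemma jacobian_transition c d e y : compatible c d -> compatible d e -> compatible c e ->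
  dom c y -> dom d y -> dom e y ->
  'J (transition c e) (chart_map c y) =
  'J (transition c d) (chart_map c y) *m 'J (transition d e) (chart_map d y).
Proof.
move=> cd de ce cy dy ey.
have dcd := transition_differentiable cd cy dy.
have dde := transition_differentiable de dy ey.
have dce := transition_differentiable ce cy ey.
rewrite -(transition_chart_map d cy) in dde *.
apply: etrans (jacobian_comp dcd dde); apply: near_eq_jacobian dce.
have := open_nbhs_nbhs (conj (overlap_open (c := c) (d := d)) (overlap_chart_map cy dy)).
by apply: filterS => u [cu du]; rewrite /transition /= chart_mapK.
Qed.

Section SubChart.
Variables (c : chart R n T) (N : set 'rV[R]_n) (Phi Psi : 'rV[R]_n -> 'rV[R]_n).
Hypotheses (oN : open N) (NC : N `<=` cod c) (oV : open (Phi @` N)).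
Hypothesis PsiK : forall u, N u -> Psi (Phi u) = u.
Hypothesis sPhi : smooth_on N Phi.
Hypothesis sPsi : smooth_on (Phi @` N) Psi.

Let D : set T := dom c `&` chart_map c @^-1` N.

Let PsiN v : (Phi @` N) v -> N (Psi v) /\ Phi (Psi v) = v.
Proof. by move=> [u Nu <-]; rewrite PsiK. Qed.

Fact sub_open : open D.
Proof. by apply: open_preimage_on (@open_dom _ _ _ c) _ oN => y; exact: continuous_chart_map. Qed.

Fact sub_chart_map_cod y : D y -> (Phi @` N) ((Phi \o chart_map c) y).
Proof. by move=> [cy Ny]; exists (chart_map c y). Qed.

Fact sub_para_dom v : (Phi @` N) v -> D ((para c \o Psi) v).
Proof.
move=> /PsiN [NP _]; split; first exact/para_dom/NC.
by rewrite /= paraK //; exact: NC.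
Qed.

Fact sub_chart_mapK y : D y -> (para c \o Psi) ((Phi \o chart_map c) y) = y.
Proof. by move=> [cy Ny]; rewrite /= PsiK // chart_mapK. Qed.

Fact sub_paraK v : (Phi @` N) v -> (Phi \o chart_map c) ((para c \o Psi) v) = v.
Proof. by move=> /PsiN [NP PP]; rewrite /= paraK //; exact: NC. Qed.

Fact sub_continuous_chart_map y : D y -> {for y, continuous (Phi \o chart_map c)}.
Proof.
move=> [cy Ny]; apply: continuous_comp; first exact: continuous_chart_map.
by have H : Ck_on 0 N Phi := @sPhi 0%N; exact: H.
Qed.

Fact sub_continuous_para v : (Phi @` N) v -> {for v, continuous (para c \o Psi)}.
Proof.
move=> Vv; apply: continuous_comp; first by have H : Ck_on 0 (Phi @` N) Psi := @sPsi 0%N; exact: H.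
by apply: continuous_para; apply: NC; have [] := PsiN Vv.
Qed.

(** Charts adapted to a submanifold arise this way, when the equations of the
    submanifold are among the components of [Phi]. *)
Definition sub_chart : chart R n T :=
  Chart sub_open oV sub_chart_map_cod sub_para_dom sub_chart_mapK sub_paraK
    sub_continuous_chart_map sub_continuous_para.

Lemma sub_chart_compatible e : compatible c e -> compatible sub_chart e.
Proof.
move=> [ce ec]; split=> k.
  apply: (Ck_on_compmx (t := Psi) (h := transition c e) (overlap_open (c := _) (d := _))
    (overlap_open (c := c) (d := e))) => //.
  - by move=> v [/PsiN [NP _] ev]; split=> //; exact: NC.
  - by apply: Ck_onS (sPsi k) => v [].
apply: (Ck_on_compmx (t := transition e c) (h := Phi) (overlap_open (c := _) (d := _)) oN) => //.
- by move=> v [ev [cv Nv]].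
- by apply: Ck_onS (ec k) => v [ev [cv Nv]].
Qed.

End SubChart.
End OneSpace.

Lemma slice_closed k : closed (slice k : set 'rV[R]_n).
Proof.
rewrite -openC.
have -> : ~` (slice k : set 'rV[R]_n) =
    \bigcup_(i in [set i : 'I_n | (k <= i)%N]) ((fun w : 'rV[R]_n => w 0 i) @^-1` [set t | t != 0]).
  apply/seteqP; split=> [w /existsNP [i /not_implyP [ki /eqP wi]]|w [i ki /= wi] H].
    by exists i.
  by move: wi; rewrite H // eqxx.
apply: bigcup_open => i _; apply: open_comp; last exact: open_neq.
by move=> w _; exact: coord_continuous.
Qed.

Section Tangent.
Variable (X : smoothManifold R n).
Implicit Types c d e : chart R n X.

(** The transition between two slice charts of [M] maps slice to slice, since
    both slices describe [M]; so does its derivative.  Hence the tangent space of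
    [M] does not depend on the slice chart. *)
Lemma slice_chart_tangent k (M : set X) d d' y (s : 'rV[R]_n) :
  slice_chart k M d -> slice_chart k M d' -> M y -> dom d y -> dom d' y ->
  slice k s -> slice k (s *m 'J (transition d' d) (chart_map d' y)).
Proof.
move=> [ad Md] [ad' Md'] My dy d'y ss i ki.
have dT := transition_differentiable (atlas_compatible ad' ad) d'y dy.
set u' := chart_map d' y; pose h z := transition d' d z 0 i.
have dh : differentiable h u' by exact: ((differentiable_mxP _ _).1 dT).
rewrite -deriveEjacobian // derive_mxE //.
have dh0 : differentiable h (0 *: s + u') by rewrite scale0r add0r.
have := @derive_val _ _ _ _ _ _ _ (is_derive_line dh0); rewrite scale0r add0r => <-.
have su' : slice k u'.
  by have [_] : (dom d' `&` chart_map d' @^-1` slice k) y by rewrite -Md'.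
apply: (@etrans _ _ ('D_1 (cst (0 : R)) (0 : R))); last exact: derive_cst.
apply: near_eq_derive.
have lc : (fun t : R => t *: s + u') t @[t --> 0] --> u'.
  rewrite -[X in _ --> X](add0r u'); apply: cvgD; last exact: cvg_cst.
  by rewrite -(scale0r s); exact: scalel_continuous.
have n0 : \forall t \near (0 : R), overlap d' d (t *: s + u').
  have oT := overlap_open (c := d') (d := d).
  exact: (lc _ (open_nbhs_nbhs (conj oT (overlap_chart_map d'y dy)))).
near=> t; have [ct dt] : overlap d' d (t *: s + u') by near: t.
have Mt : (M `&` dom d') (para d' (t *: s + u')).
  rewrite Md'; split; first exact: para_dom.
  by rewrite /= paraK // => j kj; rewrite !mxE ss // su' // mulr0 addr0.
have : (M `&` dom d) (para d' (t *: s + u')) by split=> //; case: Mt.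
by rewrite Md => -[_]; apply.
Unshelve. all: by end_near. Qed.

End Tangent.

End Charts.

Section NormalForm.
Context {R : realType} {n : nat}.

(** The matrices [A] and [B] come from the factorization of [H] into an
    invertible matrix, the partial identity of rank [r], and another invertible
    matrix.  [B] undoes the last factor, leaving [r] independent columns; [A]
    supplies the missing columns of the first factor.  The reversal [P] moves
    the columns coming from [H] to the end, where the model slice prescribes
    zeros. *)
Lemma rank_normal_form (H : 'M[R]_n) : exists (k : nat) (A B : 'M[R]_n),
  [/\ (k <= n)%N, A + H *m B \in unitmx, forall u : 'rV_n, slice k (u *m A) &
      forall v : 'rV_n, slice k (v *m (A + H *m B)) -> v *m H = 0].
Proof.
pose r := \rank H; pose s : 'S_n := perm (@rev_ord_inj n).
have rn : (r <= n)%N := rank_leq_row H.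
pose P : 'M[R]_n := perm_mx s.
have sV j : (s^-1)%g j = rev_ord j.
  by apply: (@perm_inj _ s); rewrite permKV permE rev_ordK.
have PE m (A : 'M[R]_(m, n)) i j : (A *m P) i j = A i (rev_ord j).
  by rewrite /P -[s]invgK -col_permE mxE sV.
pose C := col_ebase H.
have HB : H *m (invmx (row_ebase H) *m P) = C *m pid_mx r *m P.
  by rewrite -{1}(mulmx_ebase H) -!mulmxA (mulKVmx (row_ebase_unit H)).
have AHB : C *m copid_mx r *m P + H *m (invmx (row_ebase H) *m P) = C *m P.
  by rewrite HB -mulmxDl -mulmxDr /copid_mx subrK mulmx1.
have pidE (y : 'rV[R]_n) l : (y *m (pid_mx r : 'M[R]_n)) 0 l = if (l < r)%N then y 0 l else 0.
  rewrite mxE (bigD1 l) //= big1 ?addr0 => [|j jl].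
    by rewrite mxE eqxx; case: ifP; rewrite ?mulr1 ?mulr0.
  by rewrite mxE -[_ == _ :> nat]/(j == l) (negPf jl) mulr0.
exists (n - r)%N, (C *m copid_mx r *m P), (invmx (row_ebase H) *m P); split.
- exact: leq_subr.
- by rewrite AHB unitmx_mul col_ebase_unit unitmx_perm.
- move=> u j kj; rewrite !mulmxA PE /copid_mx mulmxBr mulmx1 mxE [X in _ + X]mxE pidE.
  have -> : (rev_ord j < r)%N by rewrite /=; have := ltn_ord j; lia.
  by rewrite subrr.
move=> v; rewrite AHB => vs; rewrite -(mulmx_ebase H) !mulmxA.
suff -> : v *m col_ebase H *m (pid_mx r : 'M[R]_n) = 0 by rewrite mul0mx.
apply/rowP => l; rewrite pidE [RHS]mxE; case: ifP => // lr.
have := vs (rev_ord l); rewrite mulmxA PE rev_ordK; apply.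
by rewrite /=; have := ltn_ord l; lia.
Qed.

Lemma derive_min0 (O : set 'rV[R]_n) (F : 'rV[R]_n -> R) u w : open O -> O u ->
  (forall z, O z -> differentiable F z) -> (forall z, F u <= F z) -> 'D_w F u = 0.
Proof.
move=> oO Ou dF Fmin.
have lc : (fun t : R => t *: w + u) t @[t --> 0] --> u.
  rewrite -[X in _ --> X](add0r u); apply: cvgD; last exact: cvg_cst.
  by rewrite -(scale0r w); exact: scalel_continuous.
have /nbhs_ballP [e /= e0 He] := lc _ (open_nbhs_nbhs (conj oO Ou)).
have O0 t : t \in `](- e), e[%R -> O (t *: w + u).
  move=> te; apply: (He t); rewrite -ball_normE /= sub0r normrN ltr_norml.
  by move: te; rewrite in_itv.
have dl t : t \in `](- e), e[%R -> is_derive t 1 (fun t => F (t *: w + u)) ('D_w F (t *: w + u)).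
  by move=> /O0 /dF; exact: is_derive_line.
have i0 : 0 \in `](- e), e[%R by rewrite in_itv /= oppr_lt0 e0.
have := @derive1_at_min R (fun t => F (t *: w + u)) (- e) e 0 _ _ i0 _.
case.
- by rewrite le_eqVlt gtrN ?orbT.
- by move=> t /dl [].
- by move=> t _; rewrite scale0r add0r.
- by move=> _; have [_ ->] := dl 0 i0; rewrite scale0r add0r.
Qed.

End NormalForm.

(** * The gradient at a critical point *)

Section CriticalPoints.
Context {R : realType} {n : nat} {X : smoothManifold R n}.
Variables (g : riemannianMetric X) (f : X -> R) (c : chart R n X).
Hypotheses (f_smooth : smooth_function f) (ac : atlas c).

Definition partials (u : 'rV[R]_n) : 'rV[R]_n :=
  \row_j 'D_(delta_mx 0 j) (f \o para c) u.

Lemma partials_smooth : smooth_on (cod c) partials.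
Proof.
move=> k; apply/(Ck_on_mxP _ _ (@open_cod _ _ _ c)) => i j.
have [_ /(_ (delta_mx 0 j))] := f_smooth ac k.+1.
by apply: (eq_Ck_on (@open_cod _ _ _ c)) => u _; rewrite mxE.
Qed.

Lemma partials_min0 u : cod c u -> (forall y, f (para c u) <= f y) -> partials u = 0.
Proof.
move=> cu fmin; apply/rowP => j; rewrite !mxE.
have [dF _] : Ck_on 1 (cod c) (f \o para c) := @f_smooth c ac 1%N.
by apply: (derive_min0 _ (@open_cod _ _ _ c) cu dF) => z; exact: fmin.
Qed.

Lemma metric_unit u : cod c u -> g c u \in unitmx.
Proof.
move=> cu; have gpos w := @metric_pos _ _ _ g c u w ac cu.
have free1 : row_free (1%:M : 'M[R]_n) by rewrite row_free_unit unitmx1.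
have := gram_det_neq0 gpos free1.
by rewrite mul1mx trmx1 mulmx1 unitmxE unitfE.
Qed.

(** The gradient is [partials] times the inverse metric.  Where [partials]
    vanishes, the Christoffel terms and the derivative of the metric drop out,
    leaving the Hessian. *)
Lemma levi_civita_gradient0 u w : cod c u -> partials u = 0 ->
  w *m 'J partials u = 0 -> levi_civita g c w (gradient g f c) u = 0.
Proof.
move=> cu crit wH.
have [dh _] : Ck_on 1 (cod c) partials := @partials_smooth 1%N.
have [dg _] : Ck_on 1 (cod c) (fun u => invmx (g c u)).
  apply: Ck_on_invmx (@open_cod _ _ _ c) _ (@metric_smooth _ _ _ g c ac 1%N).
  exact: metric_unit.
have [_ DY] := derive_mulmx w (dh _ cu) (dg _ cu).
have Y0 : gradient g f c u = 0 by rewrite [LHS](_ : _ = partials u *m invmx (g c u)) // crit mul0mx.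
rewrite /levi_civita.
have -> : 'D_w (gradient g f c) u = 0.
  apply: etrans DY _; rewrite crit mul0mx addr0 (deriveEjacobian _ (dh _ cu)) wH.
  by rewrite mul0mx.
rewrite add0r; apply/rowP => l; rewrite !mxE big1 // => i _; rewrite big1 // => j _.
by rewrite Y0 mxE mulr0.
Qed.

End CriticalPoints.

(** * Free submanifolds containing the zero set *)

Theorem proposition7p8 (R : realType) (n p : nat) (X : smoothManifold R n)
    (g : riemannianMetric X) (phi : differentialForm X p)
    (hphi : calibrated g phi)
    (f : X -> R) (f_smooth : smooth_function f) (f_ge0 : forall y, 0 <= f y)
    (f_psh : forall y, f y = 0 -> strictly_phi_psh g phi f y)
    (x : X) (hx : f x = 0) :
  exists (U M : set X) (k : nat),
    [/\ open U, U x, proper_submanifold k U M, phi_free g phi k M &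
        [set y | f y = 0] `&` U `<=` M].
Proof.
have [p_gt0 _ _] := hphi.
have [c ac cx] := atlas_cover x.
set u0 := chart_map c x; have cu0 : cod c u0 by exact: chart_map_cod.
have oC := @open_cod _ _ _ c.
(* The equations of [M]: they vanish at every zero of [f], not only at [x]. *)
pose h := partials f c.
have crit u : cod c u -> f (para c u) = 0 -> h u = 0.
  by move=> cu fu; apply: partials_min0 => // y; rewrite fu.
have xu0 : para c u0 = x by exact: chart_mapK.
have h0 : h u0 = 0 by apply: crit; rewrite ?xu0.
have sh : smooth_on (cod c) h by exact: partials_smooth.
have [k [A [B [kn ABunit Aslice ABker]]]] := rank_normal_form ('J h u0).
pose Phi u := u *m A + h u *m B.
have sPhi : smooth_on (cod c) Phi.
  move=> l; apply: Ck_onD => //; apply: Ck_on_mulmx => //; try exact: Ck_on_cst.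
  exact: Ck_on_id.
have dPhi u : cod c u -> differentiable Phi u.
  by have [dP _] : Ck_on 1 (cod c) Phi := sPhi 1%N; exact: dP.
have JPhi0 : 'J Phi u0 = A + 'J h u0 *m B.
  have [dh _] : Ck_on 1 (cod c) h := sh 1%N.
  apply/row_matrixP => i; rewrite [LHS]rowE -(deriveEjacobian _ (dPhi _ cu0)).
  have [d1 D1] := derive_mulmx (delta_mx 0 i) (ex_diff : differentiable (id : 'rV[R]_n -> _) u0)
    (differentiable_cst A u0).
  have [d2 D2] := derive_mulmx (delta_mx 0 i) (dh _ cu0) (differentiable_cst B u0).
  have -> : 'D_(delta_mx 0 i) Phi u0 =
      'D_(delta_mx 0 i) (fun z => z *m A) u0 + 'D_(delta_mx 0 i) (fun z => h z *m B) u0.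
    by apply: deriveD; exact: diff_derivable.
  rewrite D1 D2 !derive_cst derive_id !mulmx0 !addr0 (deriveEjacobian _ (dh _ cu0)).
  by rewrite -mulmxA -mulmxDr -rowE.
have c_near (P : 'rV[R]_n -> Prop) : (forall u, cod c u -> P u) -> \forall u \near u0, P u.
  by move=> HP; apply: filterS (open_nbhs_nbhs (conj oC cu0)).
have no_plane : \forall u \near u0, forall v : 'M[R]_(p, n),
    ~ plane_in_slice (phi c) (g c) (fun u => 'J Phi u) k u v.
  apply: no_plane_near => //.
  - apply: c_near => u cu v i a w1 w2; exact: form_linear.
  - apply: c_near => u cu v i j; exact: form_alternating.
  - move=> v; have H : Ck_on 0 (cod c) (fun u => phi c u v) := @form_smooth _ _ _ _ phi c v ac 0%N.
    exact: H.
  - have H : Ck_on 0 (cod c) (g c) := @metric_smooth _ _ _ g c ac 0%N.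
    exact: H.
  - by move=> w; exact: metric_pos.
  - have H : Ck_on 0 (cod c) (fun u => 'J Phi u) := smooth_jacobian oC sPhi 0%N.
    exact: H.
  move=> v [vG vF vD].
  have vH i : row i v *m 'J h u0 = 0.
    apply: ABker; rewrite -JPhi0 -row_mul; exact: vD.
  (* All terms of the [phi]-Hessian of [f] on such a frame vanish. *)
  have := f_psh x hx c v ac cx (conj vG vF).
  rewrite /phi_hessian big1 ?ltxx // => i _.
  rewrite levi_civita_gradient0 //.
  apply: multilinear0 => v' i' a w1 w2; exact: form_linear.
(* Shrinking the domain to [O] makes [M] free at all of its points. *)
pose O := cod c `&` [set u | forall v : 'M[R]_(p, n),
    ~ plane_in_slice (phi c) (g c) (fun u => 'J Phi u) k u v]°.
have oO : open O by apply: openI => //; exact: open_interior.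
have Ou0 : O u0 by split.
have sPhiO : smooth_on O Phi by move=> l; apply: Ck_onS (sPhi l) => u [].
have [|N [Psi [[oN Nu0] NO oV PsiK sPsi]]] := inverse_function oO Ou0 sPhiO.
  by rewrite JPhi0.
have NC : N `<=` cod c by move=> u /NO [].
have sPhiN : smooth_on N Phi by move=> l; apply: Ck_onS (sPhi l).
pose d := sub_chart oN NC oV PsiK sPhiN sPsi.
have ad : atlas d.
  by apply: atlas_maximal => e ae; apply: sub_chart_compatible; exact: atlas_compatible.
pose M := dom d `&` chart_map d @^-1` slice k.
have dM : slice_chart k M d by split=> //; rewrite /M setIAC setIid.
exists (dom d), M, k; split.
- exact: open_dom.
- by split.
- split=> //.
  + by move=> y [].
  + exists (~` (dom d `&` chart_map d @^-1` (~` slice k))).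
      apply: open_closedC; apply: open_preimage_on (@open_dom _ _ _ d) _ _.
        by move=> y dy; exact: continuous_chart_map.
      by rewrite openC; exact: slice_closed.
    apply/seteqP; split=> y.
      by move=> [dy sy]; split=> // -[_]; exact.
    by move=> [H dy]; split=> //; apply: contrapT => ns; apply: H.
  + by move=> y My; exists d; split=> //; case: My.
- move=> [y [e [v [My ae ey [vG vF] vT]]]].
  have dy : dom d y by case: My.
  have [cy Ny] : dom c y /\ N (chart_map c y) by case: dy.
  have ec_y := overlap_chart_map ey cy.
  have cec := atlas_compatible ae ac.
  have ced := atlas_compatible ae ad.
  have tE := transition_chart_map c ey.
  (* The frame [v], read in the chart [c], contradicts [no_plane]. *)
  have /NO [_ /interior_subset] := Ny.
  move=> /(_ (v *m 'J (transition e c) (chart_map e y))); apply; split.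
  + have mc := @metric_change _ _ _ g e c _ ae ac ec_y; cbv zeta in mc.
    rewrite tE in mc; apply: etrans vG; congr (\det _).
    by rewrite mc trmx_mul !mulmxA.
  + by rewrite -tE -(@form_change _ _ _ _ phi e c _ v ae ac ec_y).
  move=> a.
  have dT := transition_differentiable cec ey cy.
  have dP : differentiable Phi (transition e c (chart_map e y)).
    by rewrite tE; exact/dPhi/(NC _ Ny).
  have JE : 'J (transition e d) (chart_map e y) =
      'J (transition e c) (chart_map e y) *m 'J Phi (chart_map c y).
    by rewrite -tE -(jacobian_comp dT dP).
  rewrite -mulmxA -JE row_mul.
  have [d' [sd' d'y ss]] : tangent_space k M e y (row a v) by apply: vT; exact: row_sub.
  have ad' : atlas d' by case: sd'.
  have ced' := atlas_compatible ae ad'.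
  have cd'd := atlas_compatible ad' ad.
  rewrite (jacobian_transition ced' cd'd ced ey d'y dy) mulmxA.
  exact: (slice_chart_tangent dM sd' My dy d'y ss).
- move=> y [fy [cy Ny]]; split=> //.
  suff : slice k (chart_map c y *m A + h (chart_map c y) *m B) by [].
  rewrite crit ?mul0mx ?addr0; [exact: Aslice|exact: (NC _ Ny)|].
  by rewrite chart_mapK.
Qed.
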